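(* Let $s, t \in T(3,1,1)$. Then $F(G(s)) = F(G(t))$ if and only if all of the following hold: (i) $s_{ijk} = t_{ijk}$ for $(ijk) \in \{(124),(145),(235)\}$; (ii) for each maximal prime power $p^k$ dividing $d_1(s)$ there exists $w_p \in \mathbb{Z}$ with $p \nmid w_p$ and $p^k \mid (t_{135} w_p - s_{135})$; and (iii) for each maximal prime power $p^k$ dividing $d_2(s)$ there exists $v_p \in \mathbb{Z}$ with $p \nmid v_p$ and $p^k \mid (t_{125} v_p - s_{125})$.
   Context: For a group $G$, $F(G)$ denotes the set of isomorphism classes of finite quotients of $G$. Let $\mathbb{Z}(5)$ be the set of all integer sequences $t = (t_{ijk} \in \mathbb{Z} \mid 1 \le i<j<k\le 5)$. For $t \in \mathbb{Z}(5)$ let $$G(t) = \langle g_1,\ldots,g_5 \mid [g_j,g_i] = g_{j+1}^{t_{i,j,j+1}} \cdots g_5^{t_{i,j,5}} \text{ for } 1 \le i<j\le 5\rangle$$ (empty products are trivial), where $[a,b] = a^{-1}b^{-1}ab$. Define $d_1(t) = \gcd(t_{145}, t_{235})$ and $d_2(t) = \gcd(t_{124}, t_{135}, d_1(t))$ (with $\gcd(a,0)=a$ for $a > 0$), and $$T(3,1,1) = \{ t \in \mathbb{Z}(5) \mid 0 < t_{124},\ 0< t_{145};\ 0 \le t_{235};\ 0 \le t_{135} \le \tfrac{d_1(t)}{2};\ 0 \le t_{125} \le \tfrac{d_2(t)}{2};\ t_{ijk} = 0 \text{ otherwise}\}.$$ A maximal prime power $p^k$ dividing an integer $d>0$ is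 the largest power of $p$ dividing $d$, for a prime $p$ dividing $d$. *)

(* Defs.v *)
From HB Require Import structures.
From mathcomp Require Import all_boot all_order all_algebra all_fingroup.
From mathcomp Require Import boolp.

Set Implicit Arguments.
Unset Strict Implicit.
Unset Printing Implicit Defensive.

Import Order.TTheory GRing.Theory Num.Theory.

(* Groups given by generators and relations. The letter [(i, false)] stands
   for the generator [i] and [(i, true)] for its formal inverse; the presented
   group is the quotient of the monoid of words by the least congruence that
   contains the relations and cancels adjacent inverse letters. *)

Section Words.
Variable I : choiceType.

Definition word := seq (I * bool).

Definition wgen (i : I) : word := [:: (i, false)].

Definition winv (w : word) : word := rev [seq (x.1, ~~ x.2) | x <- w].

Definition wcomm (u v : word) : word := winv u ++ winv v ++ u ++ v.

Definition wexp (w : word) (m : int) : word :=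
  match m with
  | Posz n => iter n (cat w) [::]
  | Negz n => iter n.+1 (cat (winv w)) [::]
  end.

Inductive word_congr (rel : word -> word -> Prop) : word -> word -> Prop :=
| WordRefl u : word_congr rel u u
| WordSym u v : word_congr rel u v -> word_congr rel v u
| WordTrans u v w :
    word_congr rel u v -> word_congr rel v w -> word_congr rel u w
| WordCat u u' v v' : word_congr rel u u' -> word_congr rel v v' ->
    word_congr rel (u ++ v) (u' ++ v')
| WordCancel i b : word_congr rel [:: (i, b); (i, ~~ b)] [::]
| WordRel u v : rel u v -> word_congr rel u v.

End Words.

Section Presentation.
Variables (I : choiceType) (rel : word I -> word I -> Prop).

Definition word_eqb (u v : word I) : bool := `[< word_congr rel u v >].

Fact word_eqb_equiv : equiv_class_of word_eqb.
Proof.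
split=> [u|u v|v u w].
- by apply/asboolP; apply: WordRefl.
- by apply/asboolP/asboolP; apply: WordSym.
- by move=> /asboolP uv /asboolP vw; apply/asboolP; apply: WordTrans vw.
Qed.

Canonical word_eqb_rel := EquivRelPack word_eqb_equiv.

Definition presented := {eq_quot word_eqb}%qT.
HB.instance Definition _ := Choice.on presented.
HB.instance Definition _ := EqQuotient.on presented.

Local Open Scope quotient_scope.
Local Notation repr := (@generic_quotient.repr _ presented).

Definition pclass (w : word I) : presented := \pi_presented w.

Lemma pclassP u v : pclass u = pclass v <-> word_congr rel u v.
Proof.
by split=> [/eqmodP/asboolP|uv]; last exact/eqmodP/asboolP.
Qed.

Lemma pclass_repr (x : presented) : pclass (repr x) = x.
Proof. exact: reprK. Qed.

Lemma congr_repr u : word_congr rel (repr (pclass u)) u.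
Proof. by apply/pclassP; rewrite pclass_repr. Qed.

Lemma winv_cat (u v : word I) : winv (u ++ v) = winv v ++ winv u.
Proof. by rewrite /winv map_cat rev_cat. Qed.

Lemma winvK : involutive (@winv I).
Proof.
move=> w; rewrite /winv map_rev revK -map_comp -[RHS]map_id.
by apply: eq_map => -[i b] /=; rewrite negbK.
Qed.

Lemma congr_mulwV u : word_congr rel (u ++ winv u) [::].
Proof.
elim: u => [|[i b] u IH]; first exact: WordRefl.
rewrite -cat1s winv_cat -catA (catA u).
apply: WordTrans (WordCancel rel i b).
apply: (WordCat (WordRefl rel [:: (i, b)])).
exact: (WordCat IH (WordRefl rel [:: (i, ~~ b)])).
Qed.

Lemma congr_mulVw u : word_congr rel (winv u ++ u) [::].
Proof. by have := congr_mulwV (winv u); rewrite winvK. Qed.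

Lemma congr_winv u v : word_congr rel u v -> word_congr rel (winv u) (winv v).
Proof.
move=> uv; have r w := WordRefl rel w.
have uV : word_congr rel (winv u) (winv u ++ v ++ winv v).
  by rewrite -{1}[winv u]cats0; apply: WordCat (r _) (WordSym (congr_mulwV v)).
apply: WordTrans uV _; rewrite catA -[X in word_congr _ _ X]cat0s.
apply: WordCat (r _); apply: WordTrans (congr_mulVw u).
exact: WordCat (r _) (WordSym uv).
Qed.

Definition pres_one : presented := pclass [::].
Definition pres_mul (x y : presented) : presented := pclass (repr x ++ repr y).
Definition pres_inv (x : presented) : presented := pclass (winv (repr x)).

Lemma pclassM u v : pclass (u ++ v) = pres_mul (pclass u) (pclass v).
Proof. by apply/pclassP/WordCat; apply/WordSym/congr_repr. Qed.

Lemma pclassV u : pclass (winv u) = pres_inv (pclass u).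
Proof. exact/pclassP/congr_winv/WordSym/congr_repr. Qed.

Fact pres_mulA : associative pres_mul.
Proof.
move=> x y z; rewrite -(pclass_repr x) -(pclass_repr y) -(pclass_repr z).
by rewrite -!pclassM catA.
Qed.

Fact pres_mul1x : left_id pres_one pres_mul.
Proof. by move=> x; rewrite -(pclass_repr x) -pclassM. Qed.

Fact pres_mulx1 : right_id pres_one pres_mul.
Proof. by move=> x; rewrite -(pclass_repr x) -pclassM cats0. Qed.

Fact pres_mulVx : left_inverse pres_one pres_inv pres_mul.
Proof.
move=> x; rewrite -(pclass_repr x) -pclassV -pclassM.
exact/pclassP/congr_mulVw.
Qed.

Fact pres_mulxV : right_inverse pres_one pres_inv pres_mul.
Proof.
move=> x; rewrite -(pclass_repr x) -pclassV -pclassM.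
exact/pclassP/congr_mulwV.
Qed.

HB.instance Definition _ := isGroup.Build presented
  pres_mulA pres_mul1x pres_mulx1 pres_mulVx pres_mulxV.

End Presentation.

(* [finite_quotient G Q]: the finite group Q is isomorphic to a quotient of G,
   i.e. is the target of an epimorphism from G. This property of Q is invariant
   under isomorphism, so F(G) = F(H) as sets of isomorphism classes means that
   it is satisfied by the same finite groups for G and for H. *)
Definition finite_quotient (G : groupType) (Q : finGroupType) : Prop :=
  exists f : {multiplicative G -> Q}, forall q : Q, exists x : G, f x = q.

Definition same_finite_quotients (G H : groupType) : Prop :=
  forall Q : finGroupType, finite_quotient G Q <-> finite_quotient H Q.

Local Open Scope ring_scope.

Definition index5 :=
  {x : nat * nat * nat | (0 < x.1.1 < x.1.2)%N && (x.1.2 < x.2 <= 5)%N}.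

Definition Z5 := index5 -> int.

(* [coef t i j k] is t_ijk; the indices are 1-based and the value 0 for indices
   that do not satisfy 1 <= i < j < k <= 5 is a dummy that is never used. *)
Definition coef (t : Z5) (i j k : nat) : int := oapp t 0 (insub (i, j, k)).

(* The generator g_k is the ordinal k - 1. *)
Definition Gt_rel (t : Z5) (u v : word 'I_5) : Prop :=
  exists i j : 'I_5, [/\ (i < j)%N,
    u = wcomm (wgen j) (wgen i) &
    v = \big[cat/[::]]_(k < 5 | (j < k)%N) wexp (wgen k) (coef t i.+1 j.+1 k.+1)].

Definition Gt (t : Z5) : groupType := presented (Gt_rel t).

Definition d1 (t : Z5) : int := gcdz (coef t 1 4 5) (coef t 2 3 5).

Definition d2 (t : Z5) : int :=
  gcdz (coef t 1 2 4) (gcdz (coef t 1 3 5) (d1 t)).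

Definition T311 (t : Z5) : Prop :=
  [/\ 0 < coef t 1 2 4 /\ 0 < coef t 1 4 5,
      0 <= coef t 2 3 5,
      0 <= coef t 1 3 5 /\ (coef t 1 3 5)%:Q <= (d1 t)%:Q / 2,
      0 <= coef t 1 2 5 /\ (coef t 1 2 5)%:Q <= (d2 t)%:Q / 2
    & forall x : index5,
        val x \notin [:: (1, 2, 4); (1, 4, 5); (2, 3, 5); (1, 3, 5); (1, 2, 5)]%N ->
        t x = 0].

(* p^k is the largest power of the prime p dividing d, and p divides d. *)
Definition maximal_prime_power (p k : nat) (d : int) : Prop :=
  [/\ prime p, (p%:Z %| d)%Z, ((p ^ k)%N%:Z %| d)%Z &
      forall m : nat, ((p ^ m)%N%:Z %| d)%Z -> (m <= k)%N].

(* Main.v *)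
From HB Require Import structures.
Require Import Defs.
From mathcomp Require Import all_boot all_order all_algebra all_fingroup.
From mathcomp Require Import cyclic boolp zify ring.

(* Write a, b, c, d, e for t_124, t_125, t_135, t_145, t_235. Conditions (ii)
   and (iii) say that gcd(c, d_1) and gcd(b, d_2) agree for s and t.
   If they do, then for every N there are integers coprime to N from which one
   builds an explicit homomorphism between the two groups that becomes
   surjective onto every quotient of order N.
   Conversely, the group law of G(s) in the coordinates of the normal form
   g1^x1 ... g5^x5 is polynomial, so it has a finite analogue over Z/m for
   every m. If F(G(s)) = F(G(t)), then G(t) maps onto the image of G(s) in it,
   for every m; writing out the relations of G(t) in coordinates gives
   congruences modulo m, up to units, between the parameters of s and t. *)

Set Implicit Arguments.
Unset Strict Implicit.
Unset Printing Implicit Defensive.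

Import Order.TTheory GRing.Theory Num.Theory.
Local Open Scope ring_scope.

(** * Integer powers in groups *)

(** No isomorphism between G(s) and G(t) is sought: an integral power map is invertible only for
    exponents 1 and -1, whereas in a group of order N every exponent prime to N is invertible. Why
    these two gcds: multiplying g1 by powers of g2 and g3, and g2 and g3 by powers of later
    generators, shifts t_135 by multiples of d and e, and t_125 by multiples of a, c, d and e. Why
    two unrelated multipliers: raising g1 to the power [al] and g2 to the power [be] leaves the
    conditions s_135 al = t_135 be modulo d_1 and s_125 al = t_125 al^2 modulo d_2. The choice al =
    v, be = w v turns them into s_135 = t_135 w and s_125 = t_125 v. The obstacle in the converse is
    that d x = 0 modulo m does not give x = 0. The coefficients to be cancelled are therefore put
    into the modulus beforehand, until the images of the generators are triangular with units on the
    diagonal. *)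

(** With the step stated as an equivalence, one computation serves both directions; in a group the
    backward one is a cancellation. *)
Lemma int_ind_iff (P : int -> Prop) :
  P 0 -> (forall n, P n <-> P (n + 1)) -> forall n, P n.
Proof.
move=> P0 PS; elim/int_ind=> [//|n IH|n IH].
  by rewrite -addn1 PoszD -PS.
by rewrite PS -addn1 PoszD opprD addrNK.
Qed.

Definition zbin (n : int) : int := (n * (n - 1) %/ 2)%Z.

Lemma zbinE n : zbin n * 2 = n * (n - 1).
Proof.
apply: divzK; elim/int_ind_iff: n => [|n]; first by rewrite mul0r dvdz0.
rewrite (_ : (n + 1) * _ = n * (n - 1) + n * 2); last by ring.
by rewrite rpredDr; [split | exact: dvdz_mull].
Qed.

Lemma zbinD m n : zbin (m + n) = zbin m + zbin n + m * n.
Proof. by apply: (mulIf (x := 2)) => //; rewrite !mulrDl !zbinE; ring. Qed.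

Lemma zbin1 : zbin 1 = 0. Proof. by []. Qed.

(** The factor 2 is a real loss, as m = n = 2 shows; the moduli chosen later carry a factor 2 to pay
    for it. *)
Lemma dvdz_zbin m n : (m * 2 %| n)%Z -> (m %| zbin n)%Z.
Proof.
move=> dv; rewrite -(@dvdz_mul2r 2) // zbinE.
exact: dvdz_mulr.
Qed.

Section IntegerPowers.
Local Open Scope group_scope.
Variable G : groupType.
Implicit Types (x y : G) (m n : int).

Definition zpow x n : G :=
  match n with Posz k => x ^+ k | Negz k => x ^- k.+1 end.

Lemma zpow0 x : zpow x 0 = 1. Proof. by []. Qed.
Lemma zpow1 x : zpow x 1 = x. Proof. by []. Qed.

Lemma zpowS x n : zpow x (n + 1)%R = zpow x n * x.
Proof.
case: n => [n|[|n]]; first by rewrite -PoszD addn1 /= expgSr.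
  by rewrite /= expg1 mulVg.
rewrite (_ : (_ + 1)%R = Negz n) ?NegzE //=; last by lia.
by rewrite [x ^+ n.+2]expgS invgM mulgVK.
Qed.

Lemma zpowD x m n : zpow x (m + n)%R = zpow x m * zpow x n.
Proof.
elim/int_ind_iff: n => [|n]; first by rewrite addr0 mulg1.
have -> : (m + (n + 1) = m + n + 1)%R by rewrite addrA.
by rewrite (zpowS x (m + n)%R) (zpowS x n) mulgA; split=> [->//|/mulIg].
Qed.

Lemma zpowN x n : zpow x (- n)%R = (zpow x n)^-1.
Proof. by apply: (mulIg (zpow x n)); rewrite -zpowD addNr mulVg. Qed.

Lemma zpowM x m n : zpow x (m * n)%R = zpow (zpow x m) n.
Proof.
elim/int_ind_iff: n => [|n]; first by rewrite mulr0.
by rewrite mulrDr mulr1 (zpowD x) (zpowS (zpow x m)); split=> [->//|/mulIg].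
Qed.

Lemma commute_zpow x y n : commute x y -> commute x (zpow y n).
Proof.
by case: n => n c; [exact: commuteX | apply/commuteV/commuteX].
Qed.

Lemma commute_zpow2 x y m n : commute x y -> commute (zpow x m) (zpow y n).
Proof. by move=> c; apply/commute_zpow/commute_sym/commute_zpow/commute_sym. Qed.

Lemma zpowMg x y n : commute x y -> zpow (x * y) n = zpow x n * zpow y n.
Proof.
move=> c; elim/int_ind_iff: n => [|n]; first by rewrite mulg1.
rewrite !zpowS -(mulgA (zpow x n)) (mulgA x).
rewrite (commute_zpow n c) -(mulgA _ x) [X in _ <-> _ = X]mulgA.
by split=> [->//|/mulIg].
Qed.

Lemma zpow1n n : zpow (1 : G) n = 1.
Proof. by case: n => n /=; rewrite expg1n ?invg1. Qed.

Lemma zpowJ x y n : zpow x n ^ y = zpow (x ^ y) n.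
Proof. by case: n => n; rewrite /= ?conjVg conjXg. Qed.

End IntegerPowers.

Section MultiplicativeMaps.
Local Open Scope group_scope.
Variables (G H : groupType) (f : {multiplicative G -> H}).

Lemma group_morph1 : f 1 = 1.
Proof. by apply: (mulIg (f 1)); rewrite -gmulfM !mul1g. Qed.

Lemma group_morphV x : f x^-1 = (f x)^-1.
Proof. by apply: (mulIg (f x)); rewrite -gmulfM !mulVg group_morph1. Qed.

Lemma group_morphX x n : f (x ^+ n) = f x ^+ n.
Proof.
elim: n => [|n IH]; first exact: group_morph1.
by rewrite !expgS gmulfM IH.
Qed.

Lemma group_morph_zpow x n : f (zpow x n) = zpow (f x) n.
Proof. by case: n => n /=; rewrite ?group_morphV group_morphX. Qed.

End MultiplicativeMaps.

(** * Presented groups *)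

Section PresentedGroups.
Local Open Scope group_scope.
Variables (I : choiceType) (rel : word I -> word I -> Prop).

Definition weval (G : groupType) (y : I -> G) (w : word I) : G :=
  foldr (fun l g => (if l.2 then (y l.1)^-1 else y l.1) * g) 1 w.

Section Eval.
Variables (G : groupType) (y : I -> G).

Lemma weval_cat u v : weval y (u ++ v) = weval y u * weval y v.
Proof. by elim: u => [|l u IH] /=; rewrite ?mul1g // IH mulgA. Qed.

Lemma weval_gen i : weval y (wgen i) = y i.
Proof. by rewrite /= mulg1. Qed.

Lemma weval_inv w : weval y (winv w) = (weval y w)^-1.
Proof.
elim: w => [|[i b] w IH] /=; first by rewrite invg1.
rewrite -cat1s winv_cat weval_cat IH invgM /= mulg1.
by case: b; rewrite ?invgK.
Qed.

Lemma weval_comm u v :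
  weval y (wcomm u v) = [~ weval y u, weval y v].
Proof. by rewrite /wcomm !weval_cat !weval_inv. Qed.

Lemma weval_exp w n : weval y (wexp w n) = zpow (weval y w) n.
Proof.
have H u k : weval y (iter k (cat u) [::]) = weval y u ^+ k.
  by elim: k => [//|k IH]; rewrite iterS weval_cat IH expgS.
by case: n => n; rewrite /wexp H //= weval_inv expVgn.
Qed.

Lemma weval_congr : (forall u v, rel u v -> weval y u = weval y v) ->
  forall u v, word_congr rel u v -> weval y u = weval y v.
Proof.
move=> H u v; elim=> {u v} //.
- by move=> u v w _ -> _ ->.
- by move=> u u' v v' _ IHu _ IHv; rewrite !weval_cat IHu IHv.
- by move=> i b /=; rewrite mulg1; case: b; rewrite /= ?mulgV ?mulVg.
Qed.

(** Von Dyck's theorem. The map evaluates the representative picked by [repr], and [weval_congr]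
    makes the choice immaterial. *)
Lemma presented_lift : (forall u v, rel u v -> weval y u = weval y v) ->
  exists f : {multiplicative presented rel -> G},
    forall i, f (pclass rel (wgen i)) = y i.
Proof.
move=> /weval_congr H.
pose f (x : presented rel) := weval y (generic_quotient.repr x).
have fE w : f (pclass rel w) = weval y w by apply/H/congr_repr.
have fM : {morph f : u v / u * v} by move=> u v; rewrite fE weval_cat.
pose fm := isMultiplicative.Build _ _ f fM.
exists (HB.pack_for {multiplicative presented rel -> G} f fm) => i.
by rewrite /= fE weval_gen.
Qed.

End Eval.

Lemma weval_presented w : weval (fun i => pclass rel (wgen i)) w = pclass rel w.
Proof.
elim: w => [//|[i b] w /= ->]; rewrite -(cat1s _ w) [RHS]pclassM.
congr (_ * _); case: b => //.
by rewrite -[RHS]/(pclass rel (winv (wgen i))) pclassV.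
Qed.

End PresentedGroups.

(** * Normal forms and the polynomial group law *)

(* The coordinates are (x1, x2, x3, x4, x5, q); they stand for the element
   g1^x1 g2^x2 g3^x3 g4^x4 g5^x5 when q = x1 (x1 - 1) / 2. The redundant
   coordinate q makes the group law polynomial over any ring. *)
Definition model (R : comNzRingType) (a b c d e : R) : Type :=
  (R * R * R * R * R * R)%type.

Section Model.
Variables (R : comNzRingType) (a b c d e : R).
Local Notation model := (model a b c d e).

HB.instance Definition _ := Choice.on model.

(** This is the result of collecting a product of two normal forms. Each g1 crossing g2 leaves g4^a,
    which leaves g5^d at every later g1 that it meets; this second-order effect is the term
    [a * d * zq]. *)
Definition model_mul (x z : model) : model :=
  let: (x1, x2, x3, x4, x5, xq) := x in
  let: (z1, z2, z3, z4, z5, zq) := z in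
  (x1 + z1, x2 + z2, x3 + z3, x4 + z4 + a * x2 * z1,
   x5 + z5 + x2 * (b * z1 + a * d * zq) + c * x3 * z1 + d * x4 * z1
     + e * x3 * z2,
   xq + zq + x1 * z1).

Definition model_one : model := (0, 0, 0, 0, 0, 0).

Definition model_inv (x : model) : model :=
  let: (x1, x2, x3, x4, x5, xq) := x in
  (- x1, - x2, - x3, - x4 + a * x2 * x1,
   - x5 + x2 * (b * x1 + a * d * (xq - x1 * x1)) + c * x3 * x1 + d * x4 * x1
     + e * x3 * x2,
   - xq + x1 * x1).

Fact model_mulA : associative model_mul.
Proof.
move=> [[[[[x1 x2] x3] x4] x5] xq] [[[[[y1 y2] y3] y4] y5] yq].
move=> [[[[[z1 z2] z3] z4] z5] zq].
by rewrite /model_mul /=; congr (_, _, _, _, _, _); ring.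
Qed.

Fact model_mul1x : left_id model_one model_mul.
Proof.
move=> [[[[[x1 x2] x3] x4] x5] xq].
by rewrite /model_mul /=; congr (_, _, _, _, _, _); ring.
Qed.

Fact model_mulx1 : right_id model_one model_mul.
Proof.
move=> [[[[[x1 x2] x3] x4] x5] xq].
by rewrite /model_mul /=; congr (_, _, _, _, _, _); ring.
Qed.

Fact model_mulVx : left_inverse model_one model_inv model_mul.
Proof.
move=> [[[[[x1 x2] x3] x4] x5] xq].
by rewrite /model_mul /model_one /=; congr (_, _, _, _, _, _); ring.
Qed.

Fact model_mulxV : right_inverse model_one model_inv model_mul.
Proof.
move=> [[[[[x1 x2] x3] x4] x5] xq].
by rewrite /model_mul /model_one /=; congr (_, _, _, _, _, _); ring.
Qed.

HB.instance Definition _ := isGroup.Build model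
  model_mulA model_mul1x model_mulx1 model_mulVx model_mulxV.
End Model.

Section FiniteModel.
Variables (R : finComNzRingType) (a b c d e : R).
HB.instance Definition _ := Finite.on (model a b c d e).
End FiniteModel.

(* Locked so that associativity rewrites do not split it. *)
HB.lock Definition tail (G : groupType) (y4 y5 : G) (m n : int) : G :=
  (zpow y4 m * zpow y5 n)%g.

Section Collection.
Local Open Scope group_scope.
Variables (a b c d e : int) (G : groupType).

Record T311_relations (y1 y2 y3 y4 y5 : G) : Prop := T311Relations {
  rel21 : y2 * y1 = y1 * y2 * (zpow y4 a * zpow y5 b);
  rel31 : y3 * y1 = y1 * y3 * zpow y5 c;
  rel41 : y4 * y1 = y1 * y4 * zpow y5 d;
  rel32 : y3 * y2 = y2 * y3 * zpow y5 e;
  rel42 : commute y4 y2;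
  rel43 : commute y4 y3;
  rel51 : commute y5 y1;
  rel52 : commute y5 y2;
  rel53 : commute y5 y3;
  rel54 : commute y5 y4 }.

Definition nform (y1 y2 y3 y4 y5 : G) (x : model a b c d e) : G :=
  let: (x1, x2, x3, x4, x5, _) := x in
  zpow y1 x1 * zpow y2 x2 * zpow y3 x3 * tail y4 y5 x4 x5.

Definition binomial_coord (x : model a b c d e) : Prop :=
  let: (x1, _, _, _, _, xq) := x in xq = zbin x1.

Variables y1 y2 y3 y4 y5 : G.
Hypothesis H : T311_relations y1 y2 y3 y4 y5.

Local Notation z := (tail y4 y5).

Lemma tail_mul m n m' n' : z m n * z m' n' = z (m + m')%R (n + n')%R.
Proof.
rewrite !tail.unlock !zpowD -!mulgA; congr (_ * _); rewrite !mulgA; congr (_ * _).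
exact: (commute_zpow2 _ _ (rel54 H)).
Qed.

Lemma tail_zpow m n k : zpow (z m n) k = z (m * k)%R (n * k)%R.
Proof.
rewrite !tail.unlock.
have y45 : commute (zpow y4 m) (zpow y5 n).
  exact/commute_sym/commute_zpow2/(rel54 H).
by rewrite (zpowMg k y45) -!zpowM.
Qed.

Lemma tail_commute2 m n k : z m n * zpow y2 k = zpow y2 k * z m n.
Proof.
rewrite tail.unlock.
apply/commute_sym/commuteM; apply/commute_zpow2/commute_sym.
  exact: rel42 H.
exact: rel52 H.
Qed.

Lemma tail_commute3 m n k : z m n * zpow y3 k = zpow y3 k * z m n.
Proof.
rewrite tail.unlock.
apply/commute_sym/commuteM; apply/commute_zpow2/commute_sym.
  exact: rel43 H.
exact: rel53 H.
Qed.

Lemma conj_of_relation (x y w : G) : x * y = y * x * w -> x ^ y = x * w.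
Proof. by move=> xy; rewrite conjgE xy -!mulgA mulKg. Qed.

Lemma conj1_5 n k : zpow y5 k ^ zpow y1 n = zpow y5 k.
Proof.
by apply/conjg_fixP/commgP/commute_zpow2/(rel51 H).
Qed.

Lemma conj1_4 n : y4 ^ zpow y1 n = y4 * zpow y5 (d * n)%R.
Proof.
elim/int_ind_iff: n => [|n]; first by rewrite conjg1 mulr0 mulg1.
have E : (y4 * zpow y5 (d * n)%R) ^ y1 = y4 * zpow y5 (d * (n + 1))%R.
  rewrite conjMg (conj_of_relation (rel41 H)) -{1}(zpow1 y1) conj1_5.
  by rewrite -mulgA -zpowD mulrDr mulr1 addrC.
by rewrite zpowS conjgM -E; split=> [->|/conjg_inj].
Qed.

Lemma conj1_3 n : y3 ^ zpow y1 n = y3 * zpow y5 (c * n)%R.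
Proof.
elim/int_ind_iff: n => [|n]; first by rewrite conjg1 mulr0 mulg1.
have E : (y3 * zpow y5 (c * n)%R) ^ y1 = y3 * zpow y5 (c * (n + 1))%R.
  rewrite conjMg (conj_of_relation (rel31 H)) -{1}(zpow1 y1) conj1_5.
  by rewrite -mulgA -zpowD mulrDr mulr1 addrC.
by rewrite zpowS conjgM -E; split=> [->|/conjg_inj].
Qed.

Lemma conj2_3 n : y3 ^ zpow y2 n = y3 * zpow y5 (e * n)%R.
Proof.
elim/int_ind_iff: n => [|n]; first by rewrite conjg1 mulr0 mulg1.
have E : (y3 * zpow y5 (e * n)%R) ^ y2 = y3 * zpow y5 (e * (n + 1))%R.
  rewrite conjMg (conj_of_relation (rel32 H)) -mulgA; congr (_ * _).
  have /commgP/conjg_fixP-> : commute (zpow y5 (e * n)%R) y2.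
    by rewrite -[y2]zpow1; apply/commute_zpow2/(rel52 H).
  by rewrite -zpowD mulrDr mulr1 addrC.
by rewrite zpowS conjgM -E; split=> [->|/conjg_inj].
Qed.

Lemma tail_conj1 m k n : z m k ^ zpow y1 n = z m (k + d * n * m)%R.
Proof.
rewrite !tail.unlock conjMg conj1_5 zpowJ conj1_4 zpowMg; last first.
  by apply: commute_zpow; apply/commute_sym/(rel54 H).
by rewrite -mulgA -zpowM -zpowD addrC.
Qed.

Lemma rel21_tail : y2 * y1 = y1 * y2 * z a b.
Proof. by rewrite tail.unlock; apply: rel21 H. Qed.

(** After k conjugations y4^(a k) is present, so the next one adds d a k to the exponent of y5; the
    sum over k < n is a d [zbin n]. *)
Lemma conj1_2 n :
  y2 ^ zpow y1 n = y2 * z (a * n)%R (b * n + a * d * zbin n)%R.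
Proof.
elim/int_ind_iff: n => [|n].
  by rewrite conjg1 !mulr0 addr0 tail.unlock !zpow0 !mulg1.
have E : (y2 * z (a * n)%R (b * n + a * d * zbin n)%R) ^ y1
    = y2 * z (a * (n + 1))%R (b * (n + 1) + a * d * zbin (n + 1))%R.
  rewrite conjMg (conj_of_relation rel21_tail) -{1}(zpow1 y1) tail_conj1.
  rewrite -mulgA tail_mul zbinD; congr (_ * z _ _); first by ring.
  by rewrite zbin1; ring.
by rewrite zpowS conjgM -E; split=> [->|/conjg_inj].
Qed.

Lemma collect21 m n : zpow y2 m * zpow y1 n =
  zpow y1 n * zpow y2 m * z (a * n * m)%R ((b * n + a * d * zbin n) * m)%R.
Proof.
have y2z p k : commute y2 (z p k).
  by rewrite -{1}[y2]zpow1; apply/commute_sym/tail_commute2.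
by rewrite conjgC zpowJ conj1_2 (zpowMg _ (y2z _ _)) tail_zpow mulgA.
Qed.

Lemma collect31 m n : zpow y3 m * zpow y1 n =
  zpow y1 n * zpow y3 m * z 0 (c * n * m)%R.
Proof.
rewrite conjgC zpowJ conj1_3 zpowMg -?zpowM ?mulgA ?tail.unlock ?zpow0 ?mul1g //.
by apply/commute_zpow/commute_sym/(rel53 H).
Qed.

Lemma collect32 m n : zpow y3 m * zpow y2 n =
  zpow y2 n * zpow y3 m * z 0 (e * n * m)%R.
Proof.
rewrite conjgC zpowJ conj2_3 zpowMg -?zpowM ?mulgA ?tail.unlock ?zpow0 ?mul1g //.
by apply/commute_zpow/commute_sym/(rel53 H).
Qed.

Lemma collect_tail m k n :
  z m k * zpow y1 n = zpow y1 n * z m (k + d * n * m)%R.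
Proof. by rewrite conjgC tail_conj1. Qed.

(** Collection from the left. Moving y2^x2 past y1^v1 produces [zbin v1] where the model has [vq],
    and [binomial_coord v] identifies the two. *)
Lemma nformM (u v : model a b c d e) : binomial_coord v ->
  nform y1 y2 y3 y4 y5 u * nform y1 y2 y3 y4 y5 v
    = nform y1 y2 y3 y4 y5 (u * v).
Proof.
case: u => [[[[[x1 x2] x3] x4] x5] xq]; case: v => [[[[[v1 v2] v3] v4] v5] vq].
move=> /= ->.
have zz w m k m' k' : w * z m k * z m' k' = w * z (m + m')%R (k + k')%R.
  by rewrite -mulgA tail_mul.
have z2 w m k n : w * z m k * zpow y2 n = w * zpow y2 n * z m k.
  by rewrite -mulgA tail_commute2 mulgA.
have z3 w m k n : w * z m k * zpow y3 n = w * zpow y3 n * z m k.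
  by rewrite -mulgA tail_commute3 mulgA.
rewrite !mulgA -(mulgA _ (z _ _)) collect_tail mulgA.
rewrite -(mulgA _ (zpow y3 x3)) collect31 !mulgA.
rewrite -(mulgA _ (zpow y2 x2)) collect21 !mulgA -zpowD.
rewrite !(z2, z3, zz).
rewrite -(mulgA _ (zpow y3 x3)) collect32 !mulgA !(z2, z3, zz).
rewrite -(mulgA _ (zpow y2 x2)) -zpowD -(mulgA _ (zpow y3 x3)) -zpowD.
by congr (_ * z _ _); ring.
Qed.

End Collection.

(** * The groups G(t) *)

Lemma coef_T311_eq0 (t : Z5) (i j k : nat) : T311 t ->
  (i, j, k) \notin [:: (1, 2, 4); (1, 4, 5); (2, 3, 5); (1, 3, 5); (1, 2, 5)]%N ->
  coef t i j k = 0.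
Proof.
case=> _ _ _ _ t0 nin; rewrite /coef; case: insubP => [x _ xE|_] //=.
by apply: t0; rewrite xE.
Qed.

Section Gt.
Local Open Scope group_scope.
Variables (t : Z5) (ht : T311 t).
Local Notation a := (coef t 1 2 4).
Local Notation b := (coef t 1 2 5).
Local Notation c := (coef t 1 3 5).
Local Notation d := (coef t 1 4 5).
Local Notation e := (coef t 2 3 5).

Definition Gt_relator (G : groupType) (y : nat -> G) (j : nat) (i : nat) : G :=
  \prod_(0 <= k < 5 | (j < k)%N) zpow (y k) (coef t i.+1 j.+1 k.+1).

Lemma Gt_relE (G : groupType) (y : nat -> G) :
  (forall u v, Gt_rel t u v ->
     weval (fun i : 'I_5 => y i) u = weval (fun i : 'I_5 => y i) v) <->
  (forall i j, (i < j < 5)%N -> y j * y i = y i * y j * Gt_relator y j i).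
Proof.
have E (i j : 'I_5) : weval (fun i : 'I_5 => y i)
    (\big[cat/[::]]_(k < 5 | (j < k)%N) wexp (wgen k) (coef t i.+1 j.+1 k.+1))
    = Gt_relator y j i.
  rewrite (big_morph _ (weval_cat _) (erefl _)) /Gt_relator big_mkord.
  by apply: eq_bigr => k _; rewrite weval_exp weval_gen.
split=> [H i j /andP[ij j5]|H _ _ [i [j [ij -> ->]]]].
  have := H _ _ (ex_intro _ (Ordinal (ltn_trans ij j5))
                   (ex_intro _ (Ordinal j5) (And3 ij erefl erefl))).
  by rewrite E weval_comm !weval_gen /= => <-; rewrite -commgC.
rewrite E weval_comm !weval_gen; apply: (mulgI (y i * y j)).
by rewrite -commgC H // ij ltn_ord.
Qed.

Lemma Gt_relations (G : groupType) (y : nat -> G) :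
  (forall i j, (i < j < 5)%N -> y j * y i = y i * y j * Gt_relator y j i) <->
  T311_relations a b c d e (y 0%N) (y 1%N) (y 2%N) (y 3%N) (y 4%N).
Proof.
have z : (coef t 1 2 3 = 0) * (coef t 1 3 4 = 0) * (coef t 2 3 4 = 0) *
    (coef t 2 4 5 = 0) * (coef t 3 4 5 = 0) by rewrite !coef_T311_eq0.
split=> [H|[r21 r31 r41 r32 r42 r43 r51 r52 r53 r54]].
  by split; rewrite /commute H // /Gt_relator unlock /= ?z ?zpow0 ?mulg1 ?mul1g.
case=> [|[|[|[|i]]]] [|[|[|[|[|j]]]]] //=; rewrite ?andbF // => _;
  rewrite /Gt_relator unlock /= ?z;
  by rewrite ?zpow0 ?mul1g ?mulg1.
Qed.

(** Indexed from 0, so [Gt_gen t k] is the generator g_(k+1). *)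
Definition Gt_gen (k : nat) : Gt t := pclass (Gt_rel t) (wgen (inord k)).

Lemma Gt_gen_relations :
  T311_relations a b c d e (Gt_gen 0) (Gt_gen 1) (Gt_gen 2) (Gt_gen 3) (Gt_gen 4).
Proof.
apply/Gt_relations/Gt_relE => u v uv.
have E : (fun i : 'I_5 => Gt_gen i) = (fun i => pclass (Gt_rel t) (wgen i)).
  by apply: funext => i; rewrite /Gt_gen inord_val.
by rewrite E !weval_presented; apply/pclassP/WordRel.
Qed.

Lemma Gt_lift (G : groupType) (y1 y2 y3 y4 y5 : G) :
  T311_relations a b c d e y1 y2 y3 y4 y5 ->
  exists f : {multiplicative Gt t -> G},
    [/\ f (Gt_gen 0) = y1, f (Gt_gen 1) = y2, f (Gt_gen 2) = y3,
        f (Gt_gen 3) = y4 & f (Gt_gen 4) = y5].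
Proof.
move=> H; pose y k := nth 1 [:: y1; y2; y3; y4; y5] k.
have /Gt_relations/Gt_relE/presented_lift[f fE] :
  T311_relations a b c d e (y 0%N) (y 1%N) (y 2%N) (y 3%N) (y 4%N) by [].
by exists f; split; rewrite fE /= inordK.
Qed.

Lemma Gt_ind (P : Gt t -> Prop) :
  P 1 -> (forall k x, (k < 5)%N -> P x -> P (Gt_gen k * x)) ->
  (forall k x, (k < 5)%N -> P x -> P ((Gt_gen k)^-1 * x)) -> forall x, P x.
Proof.
move=> P1 PM PV x; rewrite -(pclass_repr x).
elim: (generic_quotient.repr x) => [//|[i s] w IH].
rewrite -cat1s pclassM; have := IH; have := ltn_ord i.
have gi : Gt_gen i = pclass (Gt_rel t) (wgen i) by rewrite /Gt_gen inord_val.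
case: s; last by move=> /PM H /H; rewrite gi.
by move=> /PV H /H; rewrite gi -[X in X * _](pclassV (Gt_rel t)).
Qed.

Lemma Gt_nform (x : Gt t) : exists u : model a b c d e,
  binomial_coord u /\
  x = nform (Gt_gen 0) (Gt_gen 1) (Gt_gen 2) (Gt_gen 3) (Gt_gen 4) u.
Proof.
have H := Gt_gen_relations.
have nM (u v : model a b c d e) : binomial_coord u -> binomial_coord v ->
    binomial_coord (u * v).
  case: u => [[[[[x1 x2] x3] x4] x5] xq]; case: v => [[[[[v1 v2] v3] v4] v5] vq].
  by rewrite /= => -> ->; rewrite zbinD.
pose ok (g : Gt t) := exists u : model a b c d e, binomial_coord u /\
  g = nform (Gt_gen 0) (Gt_gen 1) (Gt_gen 2) (Gt_gen 3) (Gt_gen 4) u.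
have okM g h : ok g -> ok h -> ok (g * h).
  move=> [u [bu ->]] [v [bv ->]]; exists (u * v); split; first exact: nM.
  exact: nformM.
have gen k n : (k < 5)%N -> ok (zpow (Gt_gen k) n).
  case: k => [|[|[|[|[|k]]]]] // _.
  - by exists (n, 0, 0, 0, 0, zbin n)%R; rewrite /= tail.unlock !zpow0 !mulg1.
  - by exists (0, n, 0, 0, 0, 0)%R; rewrite /= tail.unlock !zpow0 !(mulg1, mul1g).
  - by exists (0, 0, n, 0, 0, 0)%R; rewrite /= tail.unlock !zpow0 !(mulg1, mul1g).
  - by exists (0, 0, 0, n, 0, 0)%R; rewrite /= tail.unlock !zpow0 !(mulg1, mul1g).
  - by exists (0, 0, 0, 0, n, 0)%R; rewrite /= tail.unlock !zpow0 !(mulg1, mul1g).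
elim/Gt_ind: x => [|k x k5|k x k5].
- exact: (gen 0%N 0).
- by apply: okM; rewrite -[Gt_gen k]zpow1; apply: gen.
- by apply: okM; rewrite -[Gt_gen k]zpow1 -zpowN; apply: gen.
Qed.

End Gt.

(** * Arithmetic of conditions (ii) and (iii) *)

(** Let k be the product of the primes that divide N but not w. A prime of N dividing w divides
    neither k nor d; any other prime of N divides k but not w. In both cases it misses w + k d. *)
Lemma coprimez_shift (w d N : int) : coprimez w d -> N != 0 ->
  exists k, coprimez (w + k * d) N.
Proof.
move=> wd N0; pose k := \prod_(p <- primes `|N| | ~~ (p%:Z %| w)%Z) p%:Z.
exists k; rewrite coprimezE; apply/negPn/negP => nc.
have [p p_pr /andP[pw pN]] : exists2 p, prime p &
    (p%:Z %| w + k * d)%Z && (p%:Z %| N)%Z.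
  have g1 : (1 < gcdn `|(w + k * d)%R| `|N|)%N.
    by rewrite ltn_neqAle eq_sym nc gcdn_gt0 !absz_gt0 N0 orbT.
  exists (pdiv (gcdn `|(w + k * d)%R| `|N|)); first exact: pdiv_prime.
  by rewrite !dvdzE /= -dvdn_gcd pdiv_dvd.
have pNn : p \in primes `|N| by rewrite mem_primes p_pr absz_gt0 N0.
have [pdw|pndw] := boolP (p%:Z %| w)%Z.
  have : (p%:Z %| k * d)%Z by rewrite -(rpredDl (x := w)).
  have cop : coprimez p%:Z d.
    exact: coprimez_dvdl wd.
  rewrite (Gauss_dvdzl _ cop) /k dvdzE /= => pk.
  have : (p %| \prod_(q <- primes `|N| | ~~ (q%:Z %| w)%Z) q)%N.
    by move: pk; rewrite (big_morph absz abszM (erefl _)) /=.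
  rewrite Euclid_dvd_prod // big_has_cond => /hasP[q].
  rewrite mem_primes => /and3P[q_pr _ _].
  by move=> /andP[qw]; rewrite dvdn_prime2 // => /eqP pq; rewrite -pq pdw in qw.
have : (p%:Z %| w)%Z.
  rewrite -(rpredDr (x := k * d)) //; apply: dvdz_mulr.
  rewrite /k (big_rem p) //= pndw; exact: dvdz_mulr.
by rewrite (negPf pndw).
Qed.

(** After division by the common gcd g, t and s become units modulo d / g, so w is prescribed only
    modulo d / g. The remaining freedom is spent by [coprimez_shift] on making w prime to N. *)
Lemma unit_multiplier (t s d N : int) : d != 0 -> N != 0 ->
  gcdz t d = gcdz s d -> exists w, coprimez w N /\ (d %| t * w - s)%Z.
Proof.
move=> d0 N0 g_eq; pose g := gcdz t d.
have g0 : g != 0 by rewrite gcdz_eq0 negb_and d0 orbT.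
have [/dvdzP[t' tE] /dvdzP[d' dE]] : (g %| t)%Z /\ (g %| d)%Z.
  by rewrite dvdz_gcdl dvdz_gcdr.
have /dvdzP[s' sE] : (g %| s)%Z by rewrite /g g_eq dvdz_gcdl.
have gg : `|g| = g by [].
have cop x : gcdz (x * g) d = g -> coprimez x d'.
  rewrite dE -mulz_gcdl => xg.
  by apply/eqP/(mulIf g0); rewrite mul1r -[X in _ * X]gg.
have /coprimezP[[u v] /= uv] : coprimez t' d' by apply: cop; rewrite -tE.
have s'd' : coprimez s' d' by apply: cop; rewrite -sE -g_eq.
have ud' : coprimez u d' by apply/coprimezP; exists (t', v); rewrite /= -uv; ring.
have [k wN] : exists k, coprimez (u * s' + k * d') N.
  by apply: coprimez_shift => //; rewrite coprimezMl ud'.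
exists (u * s' + k * d'); split=> //.
apply/dvdzP; exists (t' * k - s' * v); rewrite dE.
rewrite {1}tE {1}sE -[s' * g]mulr1 -uv; ring.
Qed.

Lemma gcdz_of_unit (t s d u v m : int) : coprimez u m -> coprimez v m ->
  (d %| m)%Z -> (d %| t * u - s * v)%Z -> gcdz t d = gcdz s d.
Proof.
move=> um vm dm dts.
have ud : coprimez d u by rewrite coprimez_sym; apply: coprimez_dvdr um.
have vd : coprimez d v by rewrite coprimez_sym; apply: coprimez_dvdr vm.
rewrite gcdzC -(Gauss_gcdzl _ ud) [RHS]gcdzC -(Gauss_gcdzl s vd).
by case/dvdzP: dts => q; move/(canRL (addrNK _)) ->; rewrite gcdzMDl.
Qed.

(** A divisor x of d divides t iff it divides s: this is tested on each p-part of x, which divides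
    the maximal power of p in d, where t and s differ by a unit. *)
Lemma gcdz_of_prime_powers (t s d : int) : 0 < d ->
  (forall p k, maximal_prime_power p k d -> exists w : int,
     ~~ (p%:Z %| w)%Z /\ ((p ^ k)%N%:Z %| t * w - s)%Z) ->
  gcdz t d = gcdz s d.
Proof.
move=> d0 H; have d_gt0 : (0 < `|d|)%N by rewrite absz_gt0 gt_eqF.
have key x : (x %| `|d|)%N -> (x %| `|t|)%N = (x %| `|s|)%N.
  move=> xd; have x0 : (0 < x)%N := dvdn_gt0 d_gt0 xd.
  suff E p : p \in \pi(x) -> (x`_p %| `|t|)%N = (x`_p %| `|s|)%N.
    by apply/(dvdn_partP _ x0)/(dvdn_partP _ x0) => D p px; rewrite ?E ?D // -E ?D.
  rewrite mem_primes => /and3P[p_pr _ px].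
  have [|w [pw ptw]] := H p (logn p `|d|).
    split=> //; rewrite ?dvdzE /= ?pfactor_dvdnn ?(dvdn_trans px xd) // => m.
    by rewrite dvdzE /= pfactor_dvdn.
  have xp : ((x`_p)%N%:Z %| t * w - s)%Z.
    by apply: dvdz_trans ptw; rewrite dvdzE /= -p_part; apply: partn_dvd.
  have cop : coprimez (x`_p)%N%:Z w.
    rewrite coprimezE /= p_part coprimeXl // prime_coprime //.
  have -> : (x`_p %| `|t|)%N = ((x`_p)%N%:Z %| t * w)%Z.
    by rewrite Gauss_dvdzl // dvdzE.
  by rewrite -(subrK s (t * w)) rpredDl // dvdzE.
congr Posz; apply/eqP; rewrite eqn_dvd !dvdn_gcd !dvdn_gcdr !andbT.
by rewrite -key ?dvdn_gcdr // dvdn_gcdl key ?dvdn_gcdr // dvdn_gcdl.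
Qed.

(** [unit_multiplier] with N = d gives a multiplier prime to d, hence prime to p. *)
Lemma prime_powers_of_gcdz (t s d : int) (p k : nat) : 0 < d ->
  gcdz t d = gcdz s d -> maximal_prime_power p k d ->
  exists w : int, ~~ (p%:Z %| w)%Z /\ ((p ^ k)%N%:Z %| t * w - s)%Z.
Proof.
move=> d0 g_eq [p_pr pd pkd _].
have d_neq0 : d != 0 by rewrite gt_eqF.
have [w [wd dts]] := unit_multiplier d_neq0 d_neq0 g_eq.
exists w; split; last exact: dvdz_trans dts.
apply/negP => pw; have : (p%:Z %| gcdz w d)%Z by rewrite dvdz_gcd pw.
by rewrite (eqP wd) dvdz1 /= => /eqP p1; rewrite p1 in p_pr.
Qed.

(** * Sufficiency *)

(* The exponents below solve, with al and be free, most of the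
   relations of G(t) in a group satisfying those of G(s); [Ec] and [Eb] are the
   only constraints left, those of [x3, x1] and [x2, x1]. *)
Section ChangeOfGenerators.
Variables (a b b' c c' d e : int) (G : groupType) (y1 y2 y3 y4 y5 : G).
Hypothesis H : T311_relations a b' c' d e y1 y2 y3 y4 y5.
Variables (al be ka rh nu la et de : int).
Hypothesis Ec : c' * al + d * de + e * et = c * be.
Hypothesis Eb : b' * al + a * d * zbin al + c' * ka * al + d * rh * al
  + e * (ka * et - la) = a * nu + b * al ^+ 2.

Local Notation nf := (@nform a b' c' d e G y1 y2 y3 y4 y5).

Lemma nform_tail m n : nf (0, 0, 0, m, n, 0) = tail y4 y5 m n.
Proof. by rewrite /= !mul1g. Qed.

Lemma change_of_generators : T311_relations a b c d e
  (nf (al, et, la, 0, 0, zbin al)) (nf (0, be, be * ka, be * rh, 0, 0))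
  (nf (0, 0, al ^+ 2, al * de, 0, 0)) (nf (0, 0, 0, al * be, be * nu, 0))
  (nf (0, 0, 0, 0, al ^+ 2 * be, 0)).
Proof.
split; rewrite /commute ?(nform_tail, tail_zpow H, tail_mul H) -?nform_tail;
  rewrite ?(nformM H) //; congr (nf (_, _, _, _, _, _)); try ring.
(* Only the fifth coordinates of the relations for (2,1) and (3,1) remain. The first is [be] times
   [Eb], the second [al ^+ 2] times [Ec]. *)
- transitivity (be * (b' * al + a * d * zbin al + c' * ka * al + d * rh * al
    + e * (ka * et - la)) + e * la * be); first by ring.
  by rewrite Eb; ring.
- transitivity (al ^+ 2 * (c' * al + d * de + e * et)); first by ring.
  by rewrite Ec; ring.
Qed.

End ChangeOfGenerators.

Section SparseNormalForms.
Local Open Scope group_scope.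
Variables (a b c d e : int) (G : groupType) (y1 y2 y3 y4 y5 : G) (m n p q : int).
Local Notation nf := (@nform a b c d e G y1 y2 y3 y4 y5).

Lemma nform123 : nf (m, n, p, 0, 0, q)%R = zpow y1 m * zpow y2 n * zpow y3 p.
Proof. by rewrite /= tail.unlock !zpow0 !mulg1. Qed.

Lemma nform234 : nf (0, m, n, p, 0, 0)%R = zpow y2 m * zpow y3 n * zpow y4 p.
Proof. by rewrite /= tail.unlock !zpow0 !mul1g mulg1. Qed.

Lemma nform45 : nf (0, 0, 0, m, n, 0)%R = zpow y4 m * zpow y5 n.
Proof. by rewrite /= tail.unlock !mul1g. Qed.

End SparseNormalForms.

Lemma T311_relations_morph (a b c d e : int) (G K : groupType)
    (f : {multiplicative G -> K}) (y1 y2 y3 y4 y5 : G) :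
  T311_relations a b c d e y1 y2 y3 y4 y5 ->
  T311_relations a b c d e (f y1) (f y2) (f y3) (f y4) (f y5).
Proof.
case=> r21 r31 r41 r32 r42 r43 r51 r52 r53 r54.
by split; rewrite /commute -?group_morph_zpow -!gmulfM; congr (f _).
Qed.

Lemma Gt_finite_quotient (s t : Z5) (hs : T311 s) (ht : T311 t) (Q : finGroupType) :
  coef s 1 2 4 = coef t 1 2 4 -> coef s 1 4 5 = coef t 1 4 5 ->
  coef s 2 3 5 = coef t 2 3 5 ->
  gcdz (coef t 1 3 5) (d1 s) = gcdz (coef s 1 3 5) (d1 s) ->
  gcdz (coef t 1 2 5) (d2 s) = gcdz (coef s 1 2 5) (d2 s) ->
  finite_quotient (Gt s) Q -> finite_quotient (Gt t) Q.
Proof.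
move=> Ea Ed Ee g1 g2 [f f_onto].
have [[a0 d0] _ _ _ _] := hs.
have d1n0 : d1 s != 0 by rewrite gcdz_eq0 negb_and gt_eqF.
have d2n0 : d2 s != 0 by rewrite gcdz_eq0 negb_and gt_eqF.
have Q0 : #|Q|%:Z != 0 by rewrite eqz_nat -lt0n; apply/card_gt0P; exists 1%g.
have [w [wQ /dvdzP[x Hx]]] := unit_multiplier d1n0 Q0 g1.
have [v [vQ /dvdzP[y Hy]]] := unit_multiplier d2n0 Q0 g2.
have [p [q pq]] := Bezoutz (coef s 1 4 5) (coef s 2 3 5).
have [p1 [q1 pq1]] := Bezoutz (coef s 1 3 5) (d1 s).
have [p2 [q2 pq2]] := Bezoutz (coef s 1 2 4) (gcdz (coef s 1 3 5) (d1 s)).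
rewrite -/(d2 s) in pq2; rewrite -/(d1 s) in pq.
(* With al = v and be = w v, [Ec] asks for d de + e et = v x d_1, and [Eb] asks to write v y d_2 as
   a combination of a, c, d and e; the three Bezout identities supply the coefficients. *)
pose de := v * x * p; pose et := v * x * q.
pose ka := y * q2 * p1; pose rh := y * q2 * q1 * p.
pose la := ka * et - v * (y * q2 * q1 * q).
pose nu := coef s 1 4 5 * zbin v - v * (y * p2).
have Ec : coef s 1 3 5 * v + coef s 1 4 5 * de + coef s 2 3 5 * et
    = coef t 1 3 5 * (w * v).
  transitivity ((x * d1 s + coef s 1 3 5) * v); first by rewrite -pq /de /et; ring.
  by rewrite -Hx; ring.
have Eb : coef s 1 2 5 * v + coef s 1 2 4 * coef s 1 4 5 * zbin v
    + coef s 1 3 5 * ka * v + coef s 1 4 5 * rh * v + coef s 2 3 5 * (ka * et - la)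
    = coef s 1 2 4 * nu + coef t 1 2 5 * v ^+ 2.
  transitivity (coef s 1 2 4 * nu + v * (y * d2 s + coef s 1 2 5)).
    by rewrite -pq2 -pq1 -pq /la /nu /ka /rh; ring.
  by rewrite -Hy; ring.
have fH : T311_relations (coef s 1 2 4) (coef s 1 2 5) (coef s 1 3 5)
    (coef s 1 4 5) (coef s 2 3 5) (f (Gt_gen s 0)) (f (Gt_gen s 1))
    (f (Gt_gen s 2)) (f (Gt_gen s 3)) (f (Gt_gen s 4)).
  exact: T311_relations_morph (Gt_gen_relations hs).
have := change_of_generators fH Ec Eb.
set x1 := nform _ _ _ _ _ (v, _, _, _, _, _).
set x2 := nform _ _ _ _ _ (0, w * v, _, _, _, _).
set x3 := nform _ _ _ _ _ (0, 0, v ^+ 2, _, _, _).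
set x4 := nform _ _ _ _ _ (0, 0, 0, v * (w * v), _, _).
set x5 := nform _ _ _ _ _ _; rewrite Ea Ed Ee.
move=> /(Gt_lift ht)[h [h1 h2 h3 h4 h5]].
pose P (z : Q) := exists g, h g = z.
have PM z z' : P z -> P z' -> P (z * z')%g.
  by move=> [g <-] [g' <-]; exists (g * g')%g; rewrite gmulfM.
have PV z : P z -> P z^-1%g.
  by move=> [g <-]; exists g^-1%g; rewrite group_morphV.
have PZ z n : P z -> P (zpow z n).
  by move=> [g <-]; exists (zpow g n); rewrite group_morph_zpow.
have PR z z' : P z' -> P (z * z')%g -> P z.
  by move=> /PV Pz' /PM/(_ Pz'); rewrite mulgK.
have PU z n : coprimez n #|Q|%:Z -> P (zpow z n) -> P z.
  case/coprimezP=> [[u1 u2] /= uE] Pz.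
  suff -> : z = zpow (zpow z n) u1 by apply: PZ.
  rewrite -zpowM -[LHS]zpow1 -uE zpowD (mulrC u2) (zpowM z #|Q|) /=.
  by rewrite -cardsT expg_cardG ?inE // zpow1n mulg1 mulrC.
have cop n : coprimez n #|Q|%:Z -> coprimez (v * n) #|Q|%:Z.
  by move=> nQ; rewrite coprimezMl vQ.
have wvQ : coprimez (w * v) #|Q|%:Z by rewrite coprimezMl wQ.
(* The generators are recovered from the last to the first: each new one is an old one to a power
   prime to the order of Q, times powers of later ones already known to lie in the image. *)
have Py5 : P (f (Gt_gen s 4)).
  apply: (PU _ (v ^+ 2 * (w * v))); first by rewrite -mulrA !cop.
  by exists (Gt_gen t 4); rewrite h5 /x5 nform45 mul1g.
have Py4 : P (f (Gt_gen s 3)).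
  apply: (PU _ (v * (w * v))); first exact: cop.
  apply: (PR _ _ (PZ _ (w * v * nu) Py5)).
  by exists (Gt_gen t 3); rewrite h4 /x4 nform45.
have Py3 : P (f (Gt_gen s 2)).
  apply: (PU _ (v ^+ 2)); first by rewrite cop.
  apply: (PR _ _ (PZ _ (v * de) Py4)).
  by exists (Gt_gen t 2); rewrite h3 /x3 nform234 mul1g.
have Py2 : P (f (Gt_gen s 1)).
  apply: (PU _ (w * v)) => //.
  apply: (PR _ _ (PZ _ (w * v * ka) Py3)).
  apply: (PR _ _ (PZ _ (w * v * rh) Py4)).
  by exists (Gt_gen t 1); rewrite h2 /x2 nform234.
have Py1 : P (f (Gt_gen s 0)).
  apply: (PU _ v) => //.
  apply: (PR _ _ (PZ _ et Py2)); apply: (PR _ _ (PZ _ la Py3)).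
  by exists (Gt_gen t 0); rewrite h1 /x1 nform123.
exists h => z; have [g <-] := f_onto z.
have Pgen k : (k < 5)%N -> P (f (Gt_gen s k)) by case: k => [|[|[|[|[|]]]]].
elim/Gt_ind: g => [|k g k5 IH|k g k5 IH].
- by exists 1%g; rewrite !group_morph1.
- by rewrite gmulfM; apply: PM => //; apply: Pgen.
- by rewrite gmulfM group_morphV; apply: PM => //; apply/PV/Pgen.
Qed.

(** * Necessity *)

(** As [h] may fail to be onto, the hypothesis is applied to its image, turned into the group type
    [[subg B]]. *)
Lemma same_finite_quotients_image (G K : groupType) (Q : finGroupType)
    (h : {multiplicative G -> Q}) : same_finite_quotients G K ->
  exists h' : {multiplicative K -> Q},
    (forall x, exists g, h' x = h g) /\ (forall g, exists x, h' x = h g).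
Proof.
pose A := [set q : Q | `[< exists g, h g = q >]].
have gA : group_set A.
  apply/group_setP; split.
    by rewrite inE; apply/asboolP; exists 1%g; rewrite group_morph1.
  move=> x y; rewrite !inE => /asboolP[g <-] /asboolP[g' <-].
  by apply/asboolP; exists (g * g')%g; rewrite gmulfM.
pose B := Group gA.
have hB g : h g \in B by rewrite inE; apply/asboolP; exists g.
pose f (g : G) : [subg B] := subg B (h g).
have fM : {morph f : x y / (x * y)%g}.
  by move=> x y; apply: val_inj; rewrite /= !subgK ?gmulfM ?groupM.
pose fh : {multiplicative G -> [subg B]} :=
  HB.pack_for {multiplicative G -> [subg B]} f (isMultiplicative.Build _ _ f fM).
have fE g : sgval (fh g) = h g by rewrite subgK.
have f_onto : finite_quotient G [subg B].
  exists fh => q; have := subgP q; rewrite inE => /asboolP[g gq].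
  by exists g; apply: val_inj; apply: etrans (fE g) gq.
case/(_ [subg B]) => /(_ f_onto)[k k_onto] _.
pose k' (x : K) : Q := sgval (k x).
have kM : {morph k' : x y / (x * y)%g} by move=> x y; rewrite /k' gmulfM.
exists (HB.pack_for {multiplicative K -> Q} k' (isMultiplicative.Build _ _ k' kM)).
split=> [x|g] /=.
  have := subgP (k x); rewrite inE => /asboolP[g gq].
  by exists g; rewrite gq.
by have [x xE] := k_onto (fh g); exists x; rewrite /k' xE fE.
Qed.

Lemma zpow_unique (G : groupType) (x : G) (V : int -> G) :
  V 0 = 1%g -> (forall n, V (n + 1) = (V n * x)%g) -> forall n, zpow x n = V n.
Proof.
move=> V0 VS; elim/int_ind_iff => [|n]; first by rewrite V0.
by rewrite zpowS VS; split=> [->//|/mulIg].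
Qed.

(** * Powers and abelian coordinates in the model *)

Section ModelPowers.
Variables (R : comNzRingType) (a b c d e : R).
Implicit Types x : model a b c d e.

(** A homomorphism to a commutative group: each commutator relation becomes a linear condition on
    the rows of its right-hand side. *)
Definition abel_row x : 'rV[R]_3 :=
  let: (x1, x2, x3, _, _, _) := x in \row_j [:: x1; x2; x3]`_j.

Lemma abel_rowM x y : abel_row (x * y)%g = abel_row x + abel_row y.
Proof.
case: x => [[[[[x1 x2] x3] x4] x5] xq]; case: y => [[[[[v1 v2] v3] v4] v5] vq].
by apply/rowP => -[[|[|[|//]]] ?]; rewrite !mxE.
Qed.

Lemma abel_row_zpow x n : abel_row (zpow x n) = n%:~R *: abel_row x.
Proof.
elim/int_ind_iff: n => [|n].
  by rewrite scale0r; apply/rowP => -[[|[|[|//]]] ?]; rewrite !mxE.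
by rewrite zpowS abel_rowM rmorphD scalerDl scale1r; split=> [->|/addIr].
Qed.

Lemma model_zpow45 (m n : R) k :
  zpow ((0, 0, 0, m, n, 0) : model a b c d e) k = (0, 0, 0, m *~ k, n *~ k, 0).
Proof.
apply: (zpow_unique (V := fun k => (0, 0, 0, m *~ k, n *~ k, 0) : model a b c d e)) => // {}k.
by rewrite /mul /= !mulrzDr !mulr1z; congr (_, _, _, _, _, _); ring.
Qed.

End ModelPowers.

Section IntegerModel.
Variables (a b c d e : int).
Local Notation Mod := (model a b c d e).
Implicit Types u v : Mod.

Let E1 : Mod := (1, 0, 0, 0, 0, 0).
Let E2 : Mod := (0, 1, 0, 0, 0, 0).
Let E3 : Mod := (0, 0, 1, 0, 0, 0).
Let E4 : Mod := (0, 0, 0, 1, 0, 0).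
Let E5 : Mod := (0, 0, 0, 0, 1, 0).

Lemma model_zpow1 n : zpow E1 n = (n, 0, 0, 0, 0, zbin n).
Proof.
apply: (zpow_unique (V := fun n => (n, 0, 0, 0, 0, zbin n) : Mod)) => // {}n.
by rewrite /mul /= zbinD; congr (_, _, _, _, _, _); ring.
Qed.

Lemma model_zpow2 n : zpow E2 n = (0, n, 0, 0, 0, 0).
Proof.
apply: (zpow_unique (V := fun n => (0, n, 0, 0, 0, 0) : Mod)) => // {}n.
by rewrite /mul /=; congr (_, _, _, _, _, _); ring.
Qed.

Lemma model_zpow3 n : zpow E3 n = (0, 0, n, 0, 0, 0).
Proof.
apply: (zpow_unique (V := fun n => (0, 0, n, 0, 0, 0) : Mod)) => // {}n.
by rewrite /mul /=; congr (_, _, _, _, _, _); ring.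
Qed.

Lemma model_relations : T311_relations a b c d e E1 E2 E3 E4 E5.
Proof.
split; rewrite /commute ?model_zpow45 /mul /=;
  by congr (_, _, _, _, _, _); ring.
Qed.

Lemma model_nform u : binomial_coord u -> nform E1 E2 E3 E4 E5 u = u.
Proof.
case: u => [[[[[x1 x2] x3] x4] x5] xq] /= ->.
rewrite tail.unlock model_zpow1 model_zpow2 model_zpow3 !model_zpow45.
by rewrite /mul /=; congr (_, _, _, _, _, _); ring.
Qed.

Section Reduction.
Variable R : comNzRingType.

(** The coordinate q is reduced separately, since for even m the residue of x1 modulo m does not
    determine that of [zbin x1]. *)
Definition model_red u : model (a%:~R : R) b%:~R c%:~R d%:~R e%:~R :=
  let: (x1, x2, x3, x4, x5, xq) := u in
  (x1%:~R, x2%:~R, x3%:~R, x4%:~R, x5%:~R, xq%:~R).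

Fact model_redM : {morph model_red : u v / (u * v)%g}.
Proof.
case=> [[[[[x1 x2] x3] x4] x5] xq] [[[[[v1 v2] v3] v4] v5] vq].
rewrite /mul /= !(rmorphD, rmorphM) /=; congr (_, _, _, _, _, _).
Qed.

HB.instance Definition _ := isMultiplicative.Build _ _ model_red model_redM.

End Reduction.
End IntegerModel.

(** For m = 0 and m = 1 the type ['Z_m] is Z/2, whence the bound on m here and below. *)
Lemma intr_Zp_eq (m : nat) (x y : int) : (1 < m)%N ->
  (x%:~R : 'Z_m) = y%:~R <-> (m%:Z %| x - y)%Z.
Proof.
move=> m1; have Z0 (n : nat) : (n%:R == 0 :> 'Z_m) = (m %| n)%N.
  by rewrite -(inj_eq val_inj) /= val_Zp_nat.
have -> : (m%:Z %| x - y)%Z = ((x - y)%:~R == 0 :> 'Z_m).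
  by case: (x - y) => n; rewrite ?NegzE ?mulrNz ?oppr_eq0 -?pmulrn Z0.
by rewrite rmorphB subr_eq0; split=> /eqP.
Qed.

(** * Epimorphisms onto finite images, with integer representatives *)

Section Epimorphisms.
Variables (a b c d e a' b' c' d' e' : int).
Local Notation Mod := (model a b c d e).
Local Notation red m := (@model_red a b c d e 'Z_m).
Implicit Types X : Mod.

(** The X_i are integral lifts of the images of the generators of G(t), so that one tuple can be
    reduced modulo every divisor of m. [epi_gen] is surjectivity onto the image of G(s), whose
    elements come from the v with [binomial_coord v]. *)
Record finite_epi (m : nat) (X1 X2 X3 X4 X5 : Mod) : Prop := FiniteEpi {
  epi_rel : T311_relations a' b' c' d' e'
    (red m X1) (red m X2) (red m X3) (red m X4) (red m X5);
  epi_gen : forall v : Mod, binomial_coord v ->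
    exists u : model a' b' c' d' e',
      red m v = nform (red m X1) (red m X2) (red m X3) (red m X4) (red m X5) u }.

Definition model_cong (m : nat) X Y : Prop :=
  let: (x1, x2, x3, x4, x5, xq) := X in
  let: (y1, y2, y3, y4, y5, yq) := Y in
  [/\ (m%:Z %| x1 - y1)%Z /\ (m%:Z %| xq - yq)%Z, (m%:Z %| x2 - y2)%Z,
      (m%:Z %| x3 - y3)%Z, (m%:Z %| x4 - y4)%Z & (m%:Z %| x5 - y5)%Z].

Lemma model_redP (m : nat) X Y : (1 < m)%N ->
  red m X = red m Y <-> model_cong m X Y.
Proof.
case: X => [[[[[x1 x2] x3] x4] x5] xq]; case: Y => [[[[[y1 y2] y3] y4] y5] yq].
move=> m1; have I x y := intr_Zp_eq x y m1; split.
  by case=> /I h1 /I h2 /I h3 /I h4 /I h5 /I hq.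
by rewrite /model_red; case=> [[/I-> /I->] /I-> /I-> /I-> /I->].
Qed.

Lemma model_red_dvd (m M : nat) X Y : (1 < m)%N -> (1 < M)%N -> (m %| M)%N ->
  red M X = red M Y -> red m X = red m Y.
Proof.
move=> m1 M1 mM /(model_redP _ _ M1) H; apply/(model_redP _ _ m1).
have D x : (M%:Z %| x)%Z -> (m%:Z %| x)%Z by apply: dvdz_trans.
case: X Y H => [[[[[x1 x2] x3] x4] x5] xq] [[[[[v1 v2] v3] v4] v5] vq].
by case=> [[h1 hq] h2 h3 h4 h5]; split; [split| | | |]; exact: D.
Qed.

(** The section [lift] need not be multiplicative; [p] is, because the class modulo m depends only
    on the class modulo M. *)
Lemma model_red_factor (m M : nat) : (1 < m)%N -> (1 < M)%N -> (m %| M)%N ->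
  exists p : {multiplicative model (a%:~R : 'Z_M) b%:~R c%:~R d%:~R e%:~R ->
                model (a%:~R : 'Z_m) b%:~R c%:~R d%:~R e%:~R},
    forall X, p (red M X) = red m X.
Proof.
move=> m1 M1 mM.
pose lift (x : model (a%:~R : 'Z_M) b%:~R c%:~R d%:~R e%:~R) : Mod :=
  let: (x1, x2, x3, x4, x5, xq) := x in
  (x1%:Z, x2%:Z, x3%:Z, x4%:Z, x5%:Z, xq%:Z).
have liftK x : red M (lift x) = x.
  case: x => [[[[[x1 x2] x3] x4] x5] xq].
  by rewrite /= -!pmulrn !natr_Zp.
pose p x := red m (lift x).
have pE X : p (red M X) = red m X by apply: (model_red_dvd m1 M1 mM); rewrite liftK.
have pM : {morph p : x y / (x * y)%g}.
  move=> x y; rewrite -{1}[x]liftK -{1}[y]liftK -gmulfM pE.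
  exact: gmulfM.
by exists (HB.pack_for {multiplicative model (a%:~R : 'Z_M) b%:~R c%:~R d%:~R e%:~R ->
   model (a%:~R : 'Z_m) b%:~R c%:~R d%:~R e%:~R} p (isMultiplicative.Build _ _ p pM)).
Qed.

Lemma nform_morph (G K : groupType) (f : {multiplicative G -> K})
    (y1 y2 y3 y4 y5 : G) (u : model a' b' c' d' e') :
  f (nform y1 y2 y3 y4 y5 u) = nform (f y1) (f y2) (f y3) (f y4) (f y5) u.
Proof.
case: u => [[[[[x1 x2] x3] x4] x5] xq].
by rewrite /nform !tail.unlock !gmulfM !group_morph_zpow.
Qed.

Lemma finite_epi_dvd (m M : nat) X1 X2 X3 X4 X5 :
  (1 < m)%N -> (1 < M)%N -> (m %| M)%N ->
  finite_epi M X1 X2 X3 X4 X5 -> finite_epi m X1 X2 X3 X4 X5.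
Proof.
move=> m1 M1 mM [R G]; have [p pE] := model_red_factor m1 M1 mM; split.
  by rewrite -!pE; apply: T311_relations_morph.
move=> v /G[u uE]; exists u.
by rewrite -!pE uE nform_morph.
Qed.

Lemma finite_epi_eq (m : nat) X1 X2 X3 X4 X5 Y1 Y2 Y3 Y4 Y5 :
  red m X1 = red m Y1 -> red m X2 = red m Y2 -> red m X3 = red m Y3 ->
  red m X4 = red m Y4 -> red m X5 = red m Y5 ->
  finite_epi m X1 X2 X3 X4 X5 -> finite_epi m Y1 Y2 Y3 Y4 Y5.
Proof.
by move=> e1 e2 e3 e4 e5 [R G]; split; rewrite -e1 -e2 -e3 -e4 -e5.
Qed.

End Epimorphisms.

Lemma finite_epi_exists (s t : Z5) (hs : T311 s) (ht : T311 t) (m : nat) :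
  same_finite_quotients (Gt s) (Gt t) -> (1 < m)%N ->
  exists X1 X2 X3 X4 X5 : model (coef s 1 2 4) (coef s 1 2 5) (coef s 1 3 5)
    (coef s 1 4 5) (coef s 2 3 5),
  [/\ [/\ binomial_coord X1, binomial_coord X2, binomial_coord X3,
          binomial_coord X4 & binomial_coord X5]
    & finite_epi (coef t 1 2 4) (coef t 1 2 5) (coef t 1 3 5)
        (coef t 1 4 5) (coef t 2 3 5) m X1 X2 X3 X4 X5].
Proof.
move=> st m1.
have relE := T311_relations_morph (@model_red _ _ _ _ _ 'Z_m) (model_relations
  (coef s 1 2 4) (coef s 1 2 5) (coef s 1 3 5) (coef s 1 4 5) (coef s 2 3 5)).
have [h [h1 h2 h3 h4 h5]] := Gt_lift hs relE.
have [h' [im1 im2]] := same_finite_quotients_image h st.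
have hE g : exists X, binomial_coord X /\ h g = model_red 'Z_m X.
  have [u [bu ->]] := Gt_nform hs g; exists u; split=> //.
  by rewrite nform_morph h1 h2 h3 h4 h5 -nform_morph model_nform.
have h'E x : exists X, binomial_coord X /\ h' x = model_red 'Z_m X.
  by have [g ->] := im1 x.
have [X1 [b1 e1]] := h'E (Gt_gen t 0).
have [X2 [b2 e2]] := h'E (Gt_gen t 1).
have [X3 [b3 e3]] := h'E (Gt_gen t 2).
have [X4 [b4 e4]] := h'E (Gt_gen t 3).
have [X5 [b5 e5]] := h'E (Gt_gen t 4).
exists X1, X2, X3, X4, X5; split=> //; split; rewrite -e1 -e2 -e3 -e4 -e5.
  exact: T311_relations_morph (Gt_gen_relations ht).
move=> v bv; have := im2 (nform (Gt_gen s 0) (Gt_gen s 1) (Gt_gen s 2)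
  (Gt_gen s 3) (Gt_gen s 4) v).
rewrite nform_morph h1 h2 h3 h4 h5 -nform_morph model_nform // => -[x <-].
by have [u [_ ->]] := Gt_nform ht x; exists u; rewrite nform_morph.
Qed.

Lemma map_row_eq0 m n (r : 'rV[int]_n) : (1 < m)%N ->
  map_mx intr r = 0 :> 'rV['Z_m]_n -> forall j, (m%:Z %| r 0%R j)%Z.
Proof.
move=> m1 /rowP H j; rewrite -[r 0 j]subr0; apply/intr_Zp_eq => //.
by have := H j; rewrite !mxE.
Qed.

Lemma abel_row_dvd (a b c d e : int) m (x1 x2 x3 x4 x5 xq : int) :
  let X : model a b c d e := (x1, x2, x3, x4, x5, xq) in
  (forall j, (m%:Z %| abel_row X 0%R j)%Z) <->
  [/\ (m%:Z %| x1)%Z, (m%:Z %| x2)%Z & (m%:Z %| x3)%Z].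
Proof.
split=> [H|[h1 h2 h3] [[|[|[|//]]] ?]]; try by rewrite mxE.
have := H (@Ordinal 3 0 isT); have := H (@Ordinal 3 1 isT).
by have := H (@Ordinal 3 2 isT); rewrite !mxE.
Qed.

(** For nonzero x and y a common multiple m returns both numbers, the factor 2 keeping m > 1.
    Against 0, the modulus z + 2 would have to divide z. *)
Lemma eq_of_gcdn (x y : nat) :
  (forall m, (1 < m)%N -> gcdn x m = gcdn y m) -> x = y.
Proof.
have zero (z : nat) : (forall m, (1 < m)%N -> gcdn 0 m = gcdn z m) -> z = 0%N.
  move=> H; have := H z.+2 isT; rewrite gcd0n => zz.
  have : (z.+2 %| z)%N by rewrite {1}zz dvdn_gcdl.
  by case: z {H zz} => // z /dvdn_leq => /(_ isT); lia.
case: x => [/zero-> //|x]; case: y => [H|y H].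
  by apply: zero => m m1; rewrite H.
have := H (x.+1 * y.+1 * 2)%N isT.
by rewrite -{1}mulnA -(mulnC y.+1) -mulnA !gcdnMr.
Qed.

Lemma eq_of_gcdz (x y : int) : 0 <= x -> 0 <= y ->
  (forall m : nat, (1 < m)%N -> gcdz x m = gcdz y m) -> x = y.
Proof.
move=> /gez0_abs<- /gez0_abs<- H; congr Posz; apply: eq_of_gcdn => m m1.
by have [] := H m m1.
Qed.

(** * Normalizing the images of the generators and reading off invariants *)

Section Normalization.
Variables (a b c d e a' b' c' d' e' : int).
Hypotheses (a_gt0 : 0 < a) (d_gt0 : 0 < d) (a'_gt0 : 0 < a') (d'_gt0 : 0 < d').
Local Notation Mod := (model a b c d e).
Local Notation red m := (@model_red a b c d e 'Z_m).
Local Notation epi := (@finite_epi a b c d e a' b' c' d' e').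
Implicit Types X : Mod.

Hypothesis epi_exists : forall m, (1 < m)%N -> exists X1 X2 X3 X4 X5 : Mod,
  [/\ [/\ binomial_coord X1, binomial_coord X2, binomial_coord X3,
          binomial_coord X4 & binomial_coord X5] & epi m X1 X2 X3 X4 X5].

Lemma abel_row_red m X : abel_row (red m X) = map_mx intr (abel_row X).
Proof.
case: X => [[[[[x1 x2] x3] x4] x5] xq].
by apply/rowP => -[[|[|[|//]]] ?]; rewrite !mxE.
Qed.

(* The relations give a multiple of each coordinate to be killed; working first
   modulo a suitable multiple of m allows one to cancel the factor. *)
Lemma epi_normalize45 m : (1 < m)%N -> exists (X1 X2 X3 : Mod) (mu nu ep : int),
  [/\ binomial_coord X1, binomial_coord X2, binomial_coord X3
    & epi m X1 X2 X3 (0, 0, 0, mu, nu, 0) (0, 0, 0, 0, ep, 0)].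
Proof.
(* The factors are used up from the right: d' for the row of X5 in the (4,1) relation, a' for the
   row of X4 in the (2,1) relation, 2 for the binomial coordinates, and the other d' for the fourth
   coordinate of X5. *)
move=> m1; pose m5 := (m * `|d'| * 2 * `|a'|)%N; pose M := (m5 * `|d'|)%N.
have D0 : (0 < `|d'|)%N by rewrite absz_gt0 gt_eqF.
have A0 : (0 < `|a'|)%N by rewrite absz_gt0 gt_eqF.
have M1 : (1 < M)%N by rewrite /M /m5; nia.
have DE : `|d'|%N%:Z = d' by rewrite gtz0_abs.
have AE : `|a'|%N%:Z = a' by rewrite gtz0_abs.
have [X1 [X2 [X3 [X4 [X5 [[b1 b2 b3 b4 b5] E]]]]]] := epi_exists M1.
have R := epi_rel E.
have row5 : forall j, (m5%:Z %| abel_row X5 0%R j)%Z.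
  have := congr1 (@abel_row _ _ _ _ _ _) (rel41 R).
  rewrite !abel_rowM abel_row_zpow [abel_row (red M X1) + _]addrC -[LHS]addr0.
  move=> /addrI/esym.
  rewrite abel_row_red -map_mxZ => /(map_row_eq0 M1) H j.
  have := H j; rewrite mxE /M PoszM DE mulrC dvdz_mul2r ?gt_eqF //.
have row4 : forall j, ((m * `|d'| * 2)%N%:Z %| abel_row X4 0%R j)%Z.
  have := congr1 (@abel_row _ _ _ _ _ _) (rel21 R).
  rewrite !abel_rowM !abel_row_zpow [abel_row (red M X1) + _]addrC -[LHS]addr0.
  move=> /addrI/esym.
  rewrite !abel_row_red -!map_mxZ -map_mxD => /(map_row_eq0 M1) H j.
  have := H j; rewrite !mxE => HM.
  have : (m5%:Z %| a' * abel_row X4 0%R j + b' * abel_row X5 0%R j)%Z.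
    by apply: dvdz_trans HM; rewrite /M PoszM dvdz_mulr.
  rewrite (rpredDr (x := b' * _)); last by apply: dvdz_mull.
  by rewrite /m5 PoszM AE (mulrC a') dvdz_mul2r ?gt_eqF.
have md1 : (1 < m * `|d'|)%N by nia.
have mdM : (m * `|d'| %| M)%N by rewrite /M /m5; do 3 apply: dvdn_mulr.
have {}E := finite_epi_dvd md1 M1 mdM E.
clear R.
move: X4 X5 b4 b5 row4 row5 E => [[[[[x1 x2] x3] mu] nu] xq] [[[[[z1 z2] z3] pi] ep] zq].
rewrite /binomial_coord => -> -> /(iffLR (abel_row_dvd _ _ _ _ _ _ _ _ _ _ _ _))[h1 h2 h3].
move=> /(iffLR (abel_row_dvd _ _ _ _ _ _ _ _ _ _ _ _))[k1 k2 k3] E.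
have hq : ((m * `|d'|)%N%:Z %| zbin x1)%Z by apply: dvdz_zbin; rewrite -PoszM.
have kq : ((m * `|d'|)%N%:Z %| zbin z1)%Z.
  by apply: dvdz_zbin; apply: dvdz_trans k1; rewrite -PoszM /m5 dvdzE /= dvdn_mulr.
have drop2 (y : int) : ((m * `|d'| * 2)%N%:Z %| y)%Z -> ((m * `|d'|)%N%:Z %| y)%Z.
  by apply: dvdz_trans; rewrite dvdzE /= dvdn_mulr.
have drop5 (y : int) : (m5%:Z %| y)%Z -> ((m * `|d'|)%N%:Z %| y)%Z.
  by apply: dvdz_trans; rewrite dvdzE /= /m5; do 2 apply: dvdn_mulr.
have {}E : epi (m * `|d'|) X1 X2 X3 (0, 0, 0, mu, nu, 0) (0, 0, 0, pi, ep, 0).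
  by apply: finite_epi_eq E => //; apply/model_redP => //=;
    rewrite !subr0 ?subrr ?dvdz0; (split; [split| | | |]); auto.
have dpi : (m%:Z %| pi)%Z.
  have := rel41 (epi_rel E).
  rewrite -group_morph_zpow -!gmulfM model_zpow45.
  move: X1 {b1 E} => [[[[[y1 y2] y3] y4] y5] yq] /(model_redP _ _ md1).
  rewrite /model_cong /mul /=; case=> _ _ _ + _.
  rewrite (_ : _ - _ = - (pi * d')); last by rewrite -mulrzz; ring.
  by rewrite rpredN PoszM DE dvdz_mul2r ?gt_eqF.
exists X1, X2, X3, mu, nu, ep; split=> //.
apply: (finite_epi_eq _ _ _ _ _ (finite_epi_dvd m1 md1 _ E)) => //.
  by apply/model_redP => //=; rewrite !subr0 ?subrr ?dvdz0.
exact: dvdn_mulr.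
Qed.

Lemma zpow_card (Q : finGroupType) (x : Q) n :
  (#|{: Q}|%:Z %| n)%Z -> zpow x n = 1%g.
Proof.
case/dvdzP=> q ->; rewrite mulrC zpowM /= -cardsT expg_cardG ?inE //.
exact: zpow1n.
Qed.

Lemma abel_row_nform (R : comNzRingType) (p1 p2 p3 p4 p5 : R)
    (y1 y2 y3 y4 y5 : model p1 p2 p3 p4 p5) (u : model a' b' c' d' e') :
  abel_row y4 = 0 -> abel_row y5 = 0 ->
  abel_row (nform y1 y2 y3 y4 y5 u)
    = map_mx intr (abel_row u)
        *m \matrix_(i < 3) abel_row (nth y1 [:: y1; y2; y3] i).
Proof.
case: u => [[[[[x1 x2] x3] x4] x5] xq] r4 r5.
rewrite /nform tail.unlock !abel_rowM !abel_row_zpow r4 r5 !scaler0 !addr0.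
apply/rowP=> j; rewrite !mxE !big_ord_recl big_ord0 !mxE /= addr0 addrA.
done.
Qed.

Lemma epi_units m : (1 < m)%N -> exists (X1 X2 X3 : Mod) (mu nu ep : int),
  [/\ [/\ binomial_coord X1, binomial_coord X2 & binomial_coord X3],
      coprimez mu m, coprimez ep m
    & epi m X1 X2 X3 (0, 0, 0, mu, nu, 0) (0, 0, 0, 0, ep, 0)].
Proof.
(* Modulo m * K, a preimage of g4 or g5 has exponents of x1, x2, x3 divisible by
   K, so that modulo m only the powers of x4 and x5 remain. *)
move=> m1; pose K := #|{: model (a%:~R : 'Z_m) b%:~R c%:~R d%:~R e%:~R}|.
have K0 : (0 < K)%N by apply/card_gt0P; exists 1%g.
have M1 : (1 < m * K)%N by nia.
have mM : (m %| m * K)%N by rewrite dvdn_mulr.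
have [X1 [X2 [X3 [mu [nu [ep [b1 b2 b3 E]]]]]]] := epi_normalize45 M1.
exists X1, X2, X3, mu, nu, ep.
have Em := finite_epi_dvd m1 M1 mM E.
set T4 : Mod := (0, 0, 0, mu, nu, 0) in E Em *.
set T5 : Mod := (0, 0, 0, 0, ep, 0) in E Em *.
have T0 (x y : int) : abel_row (red (m * K) (0, 0, 0, x, y, 0)) = 0.
  by apply/rowP => -[[|[|[|//]]] ?]; rewrite !mxE.
pose r i := abel_row (nth (red (m * K) X1)
  [:: red (m * K) X1; red (m * K) X2; red (m * K) X3] i).
pose A := \matrix_(i < 3) r i.
have rowE u : abel_row (nform (red (m * K) X1) (red (m * K) X2)
    (red (m * K) X3) (red (m * K) T4) (red (m * K) T5) u)
    = map_mx intr (abel_row u) *m A.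
  by apply: abel_row_nform; apply: T0.
have /fin_all_exists[N NE] : forall i : 'I_3, exists w : 'rV['Z_(m * K)]_3,
    w *m A = row i 1%:M.
  move=> i; pose v : Mod := ((i == 0 :> nat)%:R, (i == 1 :> nat)%:R,
    (i == 2 :> nat)%:R, 0, 0, 0).
  have bv : binomial_coord v by rewrite /=; case: (i : nat) => [|[]].
  have [u uE] := epi_gen E bv; exists (map_mx intr (abel_row u)).
  rewrite -rowE -uE abel_row_red.
  apply/rowP => j; rewrite !mxE /=.
  by case: i {v bv uE} => [[|[|[|//]]] ?]; case: j => [[|[|[|//]]] ?].
have NA : (\matrix_i N i) *m A = 1%:M.
  by apply/row_matrixP => i; rewrite row_mul rowK NE.
(* Preimages of the unit vectors give a left inverse of the square matrix [A], which is then also a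
   right inverse. *)
have A_inj (w : 'rV_3) : w *m A = 0 -> w = 0.
  by move=> wA; rewrite -[w]mulmx1 -(mulmx1C NA) mulmxA wA mul0mx.
have key (x y : int) : exists z t : int,
    (m%:Z %| x - mu * z)%Z /\ (m%:Z %| y - (nu * z + ep * t))%Z.
  have bv : binomial_coord ((0, 0, 0, x, y, 0) : Mod) by [].
  have [u uE] := epi_gen E bv.
  have : map_mx intr (abel_row u) *m A = 0.
    by rewrite -rowE -uE T0.
  move=> /A_inj/(map_row_eq0 M1).
  have [p pE] := model_red_factor a b c d e m1 M1 mM.
  have := congr1 p uE; rewrite nform_morph !pE.
  case: u {uE} => [[[[[z1 z2] z3] z4] z5] zq] uE.
  move=> /(iffLR (abel_row_dvd _ _ _ _ _ _ _ _ _ _ _ _))[h1 h2 h3].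
  exists z4, z5.
  have D (z : int) : ((m * K)%N%:Z %| z)%Z -> (K%:Z %| z)%Z.
    by apply: dvdz_trans; rewrite dvdzE /= dvdn_mull.
  move: uE; rewrite /nform tail.unlock.
  rewrite (zpow_card _ (D _ h1)) (zpow_card _ (D _ h2)) (zpow_card _ (D _ h3)).
  rewrite !mul1g -!group_morph_zpow -gmulfM !model_zpow45.
  move=> /(model_redP _ _ m1); rewrite /model_cong /mul /=.
  case=> _ _ _ h4 h5; split.
    have -> : x - mu * z4 = x - (mu *~ z4 + 0 *~ z5) by rewrite -mulrzz; ring.
    by rewrite !(mulr0, mul0r, addr0, add0r) in h4.
  have -> : y - (nu * z4 + ep * z5) = y - (nu *~ z4 + ep *~ z5) by rewrite -!mulrzz.
  by rewrite !(mulr0, mul0r, addr0, add0r) in h5.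
have cop (z w : int) : (m%:Z %| 1 - z * w)%Z -> coprimez z m.
  case/dvdzP=> q qE; apply/coprimezP; exists (w, q); rewrite /= -qE; ring.
(* Reaching g4 inverts [mu]. Reaching g5 then forces the exponent of x4 to vanish modulo m, so the
   exponent of x5 inverts [ep]. *)
have [z [t [h4 _]]] := key 1 0; have mu_m := cop _ _ h4.
have [z' [t' [h4' h5']]] := key 0 1.
have z'm : (m%:Z %| z')%Z.
  by move: h4'; rewrite sub0r rpredN Gauss_dvdzr // coprimez_sym.
split=> //; apply: (cop _ t').
rewrite (_ : 1 - _ = 1 - (nu * z' + ep * t') + nu * z'); last by ring.
by rewrite rpredD // dvdz_mull.
Qed.

Lemma epi_gen_row m (x1 x2 x3 x4 x5 xq y1 y2 y3 y4 y5 yq : int)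
    (z1 z2 z3 z4 z5 zq mu nu ep v1 v2 v3 : int) : (1 < m)%N ->
  epi m (x1, x2, x3, x4, x5, xq) (y1, y2, y3, y4, y5, yq) (z1, z2, z3, z4, z5, zq)
    (0, 0, 0, mu, nu, 0) (0, 0, 0, 0, ep, 0) ->
  exists u1 u2 u3 : int, [/\ (m%:Z %| v1 - (u1 * x1 + u2 * y1 + u3 * z1))%Z,
    (m%:Z %| v2 - (u1 * x2 + u2 * y2 + u3 * z2))%Z
    & (m%:Z %| v3 - (u1 * x3 + u2 * y3 + u3 * z3))%Z].
Proof.
move=> m1 E; have bv : binomial_coord ((v1, v2, v3, 0, 0, zbin v1) : Mod) by [].
have [[[[[[u1 u2] u3] u4] u5] uq]] := epi_gen E bv.
move=> /(congr1 (@abel_row _ _ _ _ _ _)).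
have T0 (x y : int) : abel_row (red m (0, 0, 0, x, y, 0)) = 0.
  by apply/rowP => -[[|[|[|//]]] ?]; rewrite !mxE.
rewrite /nform tail.unlock !abel_rowM !abel_row_zpow !T0 !scaler0 !addr0 => H.
exists u1, u2, u3.
have I (i : nat) (i3 : (i < 3)%N) := congr1 (fun r : 'rV_3 => r 0 (Ordinal i3)) H.
split; apply/(intr_Zp_eq _ _ m1).
- by have := I 0%N isT; rewrite !mxE /= !(rmorphD, rmorphM).
- by have := I 1%N isT; rewrite !mxE /= !(rmorphD, rmorphM).
- by have := I 2%N isT; rewrite !mxE /= !(rmorphD, rmorphM).
Qed.

(** The zeros come from relations, the units from surjectivity. Commuting with the fourth image
    kills the first coordinate of the second and third, up to [d]; the fourth coordinate of the
    (3,1) relation kills [z2], up to [a]. *)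
Lemma epi_normal_form m : (1 < m)%N ->
  exists al1 al2 al3 al4 al5 alq be2 be3 be4 be5 ga3 ga4 ga5 mu nu ep : int,
  [/\ coprimez al1 m, [/\ coprimez be2 m & coprimez ga3 m],
      coprimez mu m, coprimez ep m
    & epi m (al1, al2, al3, al4, al5, alq) (0, be2, be3, be4, be5, 0)
        (0, 0, ga3, ga4, ga5, 0) (0, 0, 0, mu, nu, 0) (0, 0, 0, 0, ep, 0)].
Proof.
move=> m1; pose m1a := (m * `|a|)%N; pose M := (m1a * 2 * `|d|)%N.
have D0 : (0 < `|d|)%N by rewrite absz_gt0 gt_eqF.
have A0 : (0 < `|a|)%N by rewrite absz_gt0 gt_eqF.
have DE : `|d|%N%:Z = d by rewrite gtz0_abs.
have AE : `|a|%N%:Z = a by rewrite gtz0_abs.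
have m1a1 : (1 < m1a)%N by rewrite /m1a; nia.
have M1 : (1 < M)%N by rewrite /M; nia.
have [X1 [X2 [X3 [mu [nu [ep [[_ b2 b3] cmu cep E]]]]]]] := epi_units M1.
move: X1 X2 X3 b2 b3 E => [[[[[x1 x2] x3] x4] x5] xq] [[[[[y1 y2] y3] y4] y5] yq].
move=> [[[[[z1 z2] z3] z4] z5] zq] /= yE zE; rewrite {yq}yE {zq}zE => E.
have dvd1 x : (M%:Z %| d * (mu * x))%Z -> ((m1a * 2)%N%:Z %| x)%Z.
  rewrite /M PoszM DE mulrC dvdz_mul2r ?gt_eqF // Gauss_dvdzr //.
  by rewrite coprimez_sym; apply: coprimez_dvdr cmu; rewrite dvdn_mulr.
have y1M : ((m1a * 2)%N%:Z %| y1)%Z.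
  apply: dvd1; have := rel42 (epi_rel E); rewrite /commute -!gmulfM.
  move=> /(model_redP _ _ M1); rewrite /model_cong /mul /=; case=> _ _ _ _.
  by congr (is_true (dvdz _ _)); ring.
have z1M : ((m1a * 2)%N%:Z %| z1)%Z.
  apply: dvd1; have := rel43 (epi_rel E); rewrite /commute -!gmulfM.
  move=> /(model_redP _ _ M1); rewrite /model_cong /mul /=; case=> _ _ _ _.
  by congr (is_true (dvdz _ _)); ring.
have drop2 (y : int) : ((m1a * 2)%N%:Z %| y)%Z -> (m1a%:Z %| y)%Z.
  by apply: dvdz_trans; rewrite dvdzE /= dvdn_mulr.
have m1aM : (m1a %| M)%N by rewrite /M -mulnA dvdn_mulr.
have mm1a : (m %| m1a)%N by rewrite /m1a dvdn_mulr.
have mM := dvdn_trans mm1a m1aM.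
have {}E : epi m1a (x1, x2, x3, x4, x5, xq) (0, y2, y3, y4, y5, 0)
    (0, z2, z3, z4, z5, 0) (0, 0, 0, mu, nu, 0) (0, 0, 0, 0, ep, 0).
  apply: finite_epi_eq (finite_epi_dvd m1a1 M1 m1aM E) => //;
  by apply/model_redP => //=; rewrite !subr0 ?subrr ?dvdz0;
    split=> //; split; rewrite ?dvdz_zbin -?PoszM ?drop2.
have cop (n : nat) (z w : int) : (n%:Z %| 1 - w * z)%Z -> coprimez z n.
  case/dvdzP=> q qE; apply/coprimezP; exists (w, q); rewrite /= -qE; ring.
(* Only [x1] is left in the first column, so it is a unit already modulo m a, where it must be
   cancelled next. *)
have [u1 [u2 [u3 []]]] := epi_gen_row 1 0 0 m1a1 E.
rewrite !mulr0 !addr0 => /cop x1_m1a _ _.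
have z2m : (m%:Z %| z2)%Z.
  have := rel31 (epi_rel E); rewrite -group_morph_zpow -!gmulfM model_zpow45.
  move=> /(model_redP _ _ m1a1); rewrite /model_cong /mul /=; case=> _ _ _ + _.
  rewrite (_ : _ - _ = z2 * a * x1); last by rewrite mul0rz; ring.
  rewrite Gauss_dvdzl; last by rewrite coprimez_sym.
  by rewrite /m1a PoszM AE dvdz_mul2r ?gt_eqF.
have {}E : epi m (x1, x2, x3, x4, x5, xq) (0, y2, y3, y4, y5, 0)
    (0, 0, z3, z4, z5, 0) (0, 0, 0, mu, nu, 0) (0, 0, 0, 0, ep, 0).
  apply: finite_epi_eq (finite_epi_dvd m1 m1a1 mm1a E) => //.
  by apply/model_redP => //=; rewrite !subr0 ?subrr ?dvdz0.
have dropc x : coprimez x M -> coprimez x m by apply: coprimez_dvdr.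
have x1m : coprimez x1 m by apply: coprimez_dvdr x1_m1a.
have killx u : (m%:Z %| 0 - (u * x1 + 0 + 0))%Z -> (m%:Z %| u)%Z.
  by rewrite !addr0 sub0r rpredN Gauss_dvdzl // coprimez_sym.
(* A preimage of (0, 1, 0) has first exponent 0 modulo m, so its second exponent inverts [y2]; (0,
   0, 1) serves [z3] in the same way. *)
have [p1 [p2 [p3 []]]] := epi_gen_row 0 1 0 m1 E.
rewrite !mulr0 => /killx p1m hp _.
have y2m : coprimez y2 m.
  apply: (cop m _ p2).
  rewrite (_ : 1 - _ = 1 - (p1 * x2 + p2 * y2 + 0) + p1 * x2); last by ring.
  by rewrite rpredD // dvdz_mulr.
have [q1 [q2 [q3 []]]] := epi_gen_row 0 0 1 m1 E.
rewrite !mulr0 => /killx q1m hq hq3.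
have q2m : (m%:Z %| q2)%Z.
  rewrite -(Gauss_dvdzl q2 (p := y2)); last by rewrite coprimez_sym.
  rewrite (_ : q2 * y2 = - (0 - (q1 * x2 + q2 * y2 + 0)) - q1 * x2); last by ring.
  by rewrite rpredB ?rpredN // dvdz_mulr.
exists x1, x2, x3, x4, x5, xq, y2, y3, y4, y5, z3, z4, z5, mu, nu, ep.
split; [by []| |exact: dropc|exact: dropc|by []].
split=> //; apply: (cop m _ q3).
rewrite (_ : 1 - _ = 1 - (q1 * x3 + q2 * y3 + q3 * z3)
  + (q1 * x3 + q2 * y3)); last by ring.
by rewrite rpredD // rpredD // dvdz_mulr.
Qed.

(** The first congruence is the fourth coordinate of the (2,1) relation; the others are the fifth
    coordinates for (4,1), (3,2), (3,1) and (2,1). *)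
Lemma epi_congruences m : (1 < m)%N ->
  exists al1 al2 al3 alq be2 be3 be4 ga3 ga4 mu nu ep : int,
  [/\ coprimez al1 m, [/\ coprimez be2 m & coprimez ga3 m],
      coprimez mu m, coprimez ep m &
   [/\ (m%:Z %| a * (be2 * al1) - a' * mu)%Z,
      (m%:Z %| d * (mu * al1) - d' * ep)%Z,
      (m%:Z %| e * (ga3 * be2) - e' * ep)%Z,
      (m%:Z %| c * (ga3 * al1) + d * ga4 * al1 + e * ga3 * al2 - c' * ep)%Z
    & (m%:Z %| b * (be2 * al1) + a * d * be2 * alq + c * be3 * al1
        + d * be4 * al1 + e * (be3 * al2 - be2 * al3) - a' * nu - b' * ep)%Z]].
Proof.
move=> m1.
have [al1 [al2 [al3 [al4 [al5 [alq [be2 [be3 [be4 [be5]]]]]]]]]] :=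
  epi_normal_form m1.
move=> [ga3 [ga4 [ga5 [mu [nu [ep [cal [cbe cga] cmu cep E]]]]]]].
exists al1, al2, al3, alq, be2, be3, be4, ga3, ga4, mu, nu, ep; split=> //.
case: (epi_rel E) => r21 r31 r41 r32 _ _ _ _ _ _.
move: r21 r31 r41 r32; rewrite -!group_morph_zpow -!gmulfM !model_zpow45.
move=> /(model_redP _ _ m1) r21 /(model_redP _ _ m1) r31.
move=> /(model_redP _ _ m1) r41 /(model_redP _ _ m1) r32.
rewrite /model_cong /mul /= in r21 r31 r41 r32.
case: r21 => _ _ _ h1 h2; case: r31 => _ _ _ _ h3.
case: r41 => _ _ _ _ h4; case: r32 => _ _ _ _ h5.
split.
- by move: h1; congr (is_true (dvdz _ _)); rewrite -!mulrzz; ring.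
- by move: h4; congr (is_true (dvdz _ _)); rewrite -!mulrzz; ring.
- by move: h5; congr (is_true (dvdz _ _)); rewrite -!mulrzz; ring.
- by move: h3; congr (is_true (dvdz _ _)); rewrite -!mulrzz; ring.
- by move: h2; congr (is_true (dvdz _ _)); rewrite -!mulrzz; ring.
Qed.

(** Letting m vary determines a, d and e. In the last two congruences all terms except those in c,
    c' or b, b' vanish modulo the respective gcd, the term a' nu because a = a' is already known. *)
Lemma epi_invariants : 0 <= e -> 0 <= e' ->
  [/\ a = a', d = d', e = e',
      gcdz c' (gcdz d e) = gcdz c (gcdz d e)
    & gcdz b' (gcdz a (gcdz c (gcdz d e))) = gcdz b (gcdz a (gcdz c (gcdz d e)))].
Proof.
move=> e0 e0'.
have gcd_m (x y u v : int) (m : nat) : coprimez u m -> coprimez v m ->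
    (m%:Z %| x * u - y * v)%Z -> gcdz x m = gcdz y m.
  by move=> um vm; apply: gcdz_of_unit um vm (dvdzz _).
have E1 : a = a'.
  apply: eq_of_gcdz (ltW a_gt0) (ltW a'_gt0) _ => m m1.
  move: (epi_congruences m1); do 12!case=> ?.
  case=> c1 [c2 c3] c4 c5 [H _ _ _ _].
  by apply: gcd_m H => //; rewrite coprimezMl c2.
have E2 : d = d'.
  apply: eq_of_gcdz (ltW d_gt0) (ltW d'_gt0) _ => m m1.
  move: (epi_congruences m1); do 12!case=> ?.
  case=> c1 [c2 c3] c4 c5 [_ H _ _ _].
  by apply: gcd_m H => //; rewrite coprimezMl c4.
have E3 : e = e'.
  apply: eq_of_gcdz => // m m1.
  move: (epi_congruences m1); do 12!case=> ?.
  case=> c1 [c2 c3] c4 c5 [_ _ H _ _].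
  by apply: gcd_m H => //; rewrite coprimezMl c3.
(* A single modulus now suffices: a multiple of both gcds, with the factor 2 to exceed 1. *)
have m1 : (1 < `|a| * `|d| * 2)%N.
  have : (0 < `|a|)%N by rewrite absz_gt0 gt_eqF.
  have : (0 < `|d|)%N by rewrite absz_gt0 gt_eqF.
  by nia.
set m := (_ * 2)%N in m1; set d1 := gcdz d e; set d2 := gcdz a _.
have ma : (a %| m%:Z)%Z by rewrite /m dvdzE /= -mulnA dvdn_mulr.
have md : (d %| m%:Z)%Z by rewrite /m dvdzE /= mulnAC dvdn_mull.
have [d1d d1e] : (d1 %| d)%Z /\ (d1 %| e)%Z by rewrite dvdz_gcdl dvdz_gcdr.
have [d2a d2d1] : (d2 %| a)%Z /\ (d2 %| gcdz c d1)%Z by rewrite dvdz_gcdl dvdz_gcdr.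
move: d2d1; rewrite dvdz_gcd => /andP[d2c d2d1].
have d2d := dvdz_trans d2d1 d1d; have d2e := dvdz_trans d2d1 d1e.
have d1m := dvdz_trans d1d md; have d2m := dvdz_trans d2a ma.
have [al1 [al2 [al3 [alq [be2 [be3 [be4 [ga3 [ga4 [mu [nu [ep []]]]]]]]]]]]] :=
  epi_congruences m1.
move=> c1 [c2 c3] c4 c5 [_ _ _ Hc Hb].
split=> //; symmetry.
- apply: (gcdz_of_unit (u := ga3 * al1) (v := ep) _ c5 d1m).
    by rewrite coprimezMl c3.
  have := dvdz_trans d1m Hc.
  rewrite (_ : _ - _ = c * (ga3 * al1) - c' * ep
    + (d * (ga4 * al1) + e * (ga3 * al2))); last by ring.
  by rewrite rpredDr // rpredD // dvdz_mulr.
- apply: (gcdz_of_unit (u := be2 * al1) (v := ep) _ c5 d2m).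
    by rewrite coprimezMl c2.
  have := dvdz_trans d2m Hb.
  rewrite (_ : _ - b' * ep = b * (be2 * al1) - b' * ep + (a * (d * be2 * alq - nu)
    + c * (be3 * al1) + d * (be4 * al1) + e * (be3 * al2 - be2 * al3))); last first.
    by rewrite E1; ring.
  rewrite rpredDr //.
  by rewrite !rpredD // dvdz_mulr.
Qed.

End Normalization.

Theorem theorem4 (s t : Z5) (hs : T311 s) (ht : T311 t) :
  same_finite_quotients (Gt s) (Gt t) <->
  [/\ [/\ coef s 1 2 4 = coef t 1 2 4,
          coef s 1 4 5 = coef t 1 4 5
        & coef s 2 3 5 = coef t 2 3 5],
      forall p k : nat, maximal_prime_power p k (d1 s) ->
        exists w : int, ~~ (p%:Z %| w)%Z /\
          ((p ^ k)%N%:Z %| coef t 1 3 5 * w - coef s 1 3 5)%Z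
    & forall p k : nat, maximal_prime_power p k (d2 s) ->
        exists v : int, ~~ (p%:Z %| v)%Z /\
          ((p ^ k)%N%:Z %| coef t 1 2 5 * v - coef s 1 2 5)%Z].
Proof.
have [[sa sd] se _ _ _] := hs; have [[ta td] te _ _ _] := ht.
have d1_gt0 : 0 < d1 s.
  by rewrite lt_def gcdz_eq0 negb_and (gt_eqF sd).
have d2_gt0 : 0 < d2 s.
  by rewrite lt_def gcdz_eq0 negb_and (gt_eqF sa).
split=> [st|[[ea ed ee] H1 H2]].
  have [ea ed ee g1 g2] := epi_invariants sa sd ta td
    (fun m => finite_epi_exists hs ht st) se te.
  by split=> [//|p k|p k]; apply: prime_powers_of_gcdz.
have g1 := gcdz_of_prime_powers d1_gt0 H1.
have g2 := gcdz_of_prime_powers d2_gt0 H2.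
(* These equalities make the hypotheses symmetric in s and t. The one for [d2] needs [g1], because
   the entries at 135 may differ. *)
have ed1 : d1 t = d1 s by rewrite /d1 ed ee.
have ed2 : d2 t = d2 s by rewrite /d2 ed1 g1 ea.
move=> Q; split; apply: Gt_finite_quotient => //; rewrite ?ed1 ?ed2 //.
Qed.
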